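(* Let $H=\sum_{J\in S}H_J$ be a $\mathsf k$-site-local Hamiltonian with parameters $\mathsf N_H,\mathsf N_P,\mathsf c_P,\mathsf N_{ind}$ as defined in the context, let $t>0$, $\varepsilon>0$, and let $S_p$ be a $p$-th order product formula over the terms $H_J$ (with $p$ and $\Upsilon(p)$ fixed constants). Then, to achieve $\|S_p(t/r)^r-e^{-iHt}\|=\mathcal O(\varepsilon)$ it suffices to choose a Trotter number $$r=\mathcal O\!\Big(\mathsf N_{ind}\,\mathsf N_H^{1/p}\,\frac{(\mathsf N_P\mathsf c_P t)^{1+1/p}}{\varepsilon^{1/p}}\Big).$$ Furthermore, if $r$ is chosen with the tight scaling $r=\Theta\big(\mathsf N_{ind}\mathsf N_H^{1/p}(\mathsf N_P\mathsf c_P t)^{1+1/p}\varepsilon^{-1/p}\big)$, and each factor $e^{-ita_\upsilon^{(J)}H_J/r}$ is itself implemented by a $p$-th order product formula over the Pauli decomposition of $H_J$ with accuracy as required for total error $\mathcal O(\varepsilon)$, then the total elementary gate count $\chi$ of the resulting circuit approximating $e^{-iHt}$ to error $\mathcal O(\varepsilon)$ satisfies $$\chi=\mathcal O\!\Big(\mathsf N_{ind}\,\mathsf N_P\,\frac{(\mathsf N_H\mathsf N_P\mathsf c_P t)^{1+1/p}}{\varepsilon^{1/p}}\Big).$$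
   Context: Let $\Lambda$ be a finite set of lattice sites, $\mathsf N_\Lambda=|\Lambda|$, each site carrying $\mathsf n_q$ qubits. A $\mathsf k$-site-local Hamiltonian is $H=\sum_{J\in S}H_J$, where $S$ is a set of ordered $\mathsf k$-tuples $J=(j_1,\dots,j_{\mathsf k})$ of sites, each $H_J$ is Hermitian and acts nontrivially only on the qubits of the sites in $J$; $\mathsf N_H=|S|$. Each $H_J$ has a Pauli decomposition $H_J=\sum_{i=1}^{\mathsf N_P^{(J)}}c_i^{(J)}P_i^{(J)}$ with distinct Pauli strings $P_i^{(J)}$ and nonzero complex coefficients; $\mathsf N_P=\max_J\mathsf N_P^{(J)}$ and $\mathsf c_P=\max_{J,i}|c_i^{(J)}|$. The induced 1-norm is $|||H|||_1=\max_{\ell\in\{1,\dots,\mathsf k\}}\max_{j\in\Lambda}\sum_{J\in S:\,j_\ell=j}\|H_J\|$, and $\mathsf N_{ind}$ is the number of terms in the sum attaining this maximum; thus $|||H|||_1\le\mathsf c_P\mathsf N_P\mathsf N_{ind}$ and $\|H\|_1:=\sum_J\|H_J\|\le\mathsf c_P\mathsf N_P\mathsf N_H$. A product formula for $H=\sum_\gamma H_\gamma$ is $S(\tau)=\prod_{\upsilon=1}^{\Upsilon}\mathcal P_\upsilon\big(\prod_\gamma e^{-i\tau a_\upsilon^{(\gamma)}H_\gamma}\big)$ with real $a_\upsilon^{(\gamma)}$, $\sum_\upsilon a_\upsilon^{(\gamma)}=1$, $\mathcal P_\upsilon$ a fixed reordering of factors; it has order $p$ if $S(\tau)=e^{-iH\tau}+\mathcal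 O(\tau^{p+1})$; $r$ (Trotter number) is the number of repetitions in $S(t/r)^r$. Cost model: the exponential of a single (scaled) Pauli string is counted as $\mathcal O(1)$ elementary gates. Asymptotics are in $\mathsf N_H,\mathsf N_P,\mathsf c_P,\mathsf N_{ind},t,1/\varepsilon$ with $p$ fixed.
   Formalization: The coefficients of the outer and inner product formulas are assumed bounded by fixed constants, and the O-constants may depend on these bounds as well as on k, p and the stage numbers; with unbounded coefficients no uniform constant exists. *)

(* Defs.v *)
From HB Require Import structures.
From mathcomp Require Import all_boot all_order all_algebra all_fingroup.
From mathcomp Require Import all_classical all_reals all_analysis.
From mathcomp Require Import complex.

Set Implicit Arguments.
Unset Strict Implicit.
Unset Printing Implicit Defensive.

Import Order.TTheory GRing.Theory Num.Theory numFieldNormedType.Exports.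
Local Open Scope ring_scope.
Local Open Scope complex_scope.

Section Defs.
Variable R : realType.

Definition csq (z : R[i]) : R := complex.Re z ^+ 2 + complex.Im z ^+ 2.
Definition cabs (z : R[i]) : R := Num.sqrt (csq z).

Definition vnorm (d : nat) (v : 'cV[R[i]]_d) : R :=
  Num.sqrt (\sum_(i < d) csq (v i 0)).

Definition opnorm (d : nat) (A : 'M[R[i]]_d) : R :=
  sup [set vnorm (A *m v) | v in [set v : 'cV[R[i]]_d | vnorm v = 1]].

Definition adjmx (d : nat) (A : 'M[R[i]]_d) : 'M[R[i]]_d :=
  \matrix_(i, j) (A j i)^*.
Definition hermitian (d : nat) (A : 'M[R[i]]_d) : Prop := adjmx A = A.

(* matrix power and ordered product (leftmost factor = index 0) *)
Definition mpow (d : nat) (A : 'M[R[i]]_d) (n : nat) : 'M[R[i]]_d :=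
  iter n (mulmx A) 1%:M.
Definition mprod (d n : nat) (F : 'I_n -> 'M[R[i]]_d) : 'M[R[i]]_d :=
  \big[mulmx/1%:M]_(i < n) F i.

Definition exp_partial (d : nat) (A : 'M[R[i]]_d) (N : nat) : 'M[R[i]]_d :=
  \sum_(n < N) ((n`!)%:R^-1 *: mpow A n).
Definition expmx (d : nat) (A : 'M[R[i]]_d) : 'M[R[i]]_d :=
  \matrix_(i, j)
    ((limn (fun N => complex.Re (exp_partial A N i j)))
     +i* (limn (fun N => complex.Im (exp_partial A N i j)))).

Inductive pauli := PI | PX | PY | PZ.

(* single-qubit Pauli matrix entries <x| sigma |y>, bit false = |0> *)
Definition pauli1 (s : pauli) (x y : bool) : R[i] :=
  match s with
  | PI => if x == y then 1 else 0
  | PX => if x == y then 0 else 1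
  | PY => if x == y then 0 else (if x then 'i else - 'i)
  | PZ => if x == y then (if x then -1 else 1) else 0
  end.

(* the system: sites 'I_NL, each carrying nq qubits *)
Definition qubit (NL nq : nat) := ('I_NL * 'I_nq)%type.
Definition basis (NL nq : nat) := {ffun qubit NL nq -> bool}.
Definition dim (NL nq : nat) := #|{: basis NL nq}|.
Definition bstate (NL nq : nat) (i : 'I_(dim NL nq)) : basis NL nq := enum_val i.

Definition pstring (NL nq : nat) := qubit NL nq -> pauli.

(* tensor product of the single-qubit Paulis, written out entrywise *)
Definition pauli_mx (NL nq : nat) (P : pstring NL nq) : 'M[R[i]]_(dim NL nq) :=
  \matrix_(i, j) \prod_(q : qubit NL nq)
     pauli1 (P q) (bstate i q) (bstate j q).

Definition Hterm (NL nq NH : nat) (NPg : 'I_NH -> nat)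
  (c : forall g, 'I_(NPg g) -> R[i]) (s : forall g, 'I_(NPg g) -> pstring NL nq)
  (g : 'I_NH) : 'M[R[i]]_(dim NL nq) :=
  \sum_(i < NPg g) (c g i *: pauli_mx (s g i)).

Definition Hsum (NL nq NH : nat) (Hg : 'I_NH -> 'M[R[i]]_(dim NL nq)) :=
  \sum_(g < NH) Hg g.

Definition local_pauli_data (k NL nq NH : nat) (J : 'I_NH -> k.-tuple 'I_NL)
  (NPg : 'I_NH -> nat) (c : forall g, 'I_(NPg g) -> R[i])
  (s : forall g, 'I_(NPg g) -> pstring NL nq) : Prop :=
  [/\ injective J,                                   (* S is a set of tuples *)
      (forall g i, c g i != 0),
      (forall g i j, (forall q, s g i q = s g j q) -> i = j),
      (forall g i (q : qubit NL nq), q.1 \notin J g -> s g i q = PI)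
    & (forall g, hermitian (Hterm c s g))].

Definition NP_of (NH : nat) (NPg : 'I_NH -> nat) : nat := \max_(g < NH) NPg g.
Definition cP_of (NH : nat) (NPg : 'I_NH -> nat) (c : forall g, 'I_(NPg g) -> R[i]) : R :=
  \big[Num.max/0]_(g < NH) \big[Num.max/0]_(i < NPg g) cabs (c g i).

Definition ind1norm (k NL NH d : nat) (J : 'I_NH -> k.-tuple 'I_NL)
  (Hg : 'I_NH -> 'M[R[i]]_d) : R :=
  \big[Num.max/0]_(l < k) \big[Num.max/0]_(j < NL)
     \sum_(g < NH | tnth (J g) l == j) opnorm (Hg g).

Definition is_Nind (k NL NH d : nat) (J : 'I_NH -> k.-tuple 'I_NL)
  (Hg : 'I_NH -> 'M[R[i]]_d) (Nind : nat) : Prop :=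
  exists (l : 'I_k) (j : 'I_NL),
    \sum_(g < NH | tnth (J g) l == j) opnorm (Hg g) = ind1norm J Hg /\
    #|[set g : 'I_NH | tnth (J g) l == j]| = Nind.

Definition expiH (d : nat) (tau : R) (A : 'M[R[i]]_d) : 'M[R[i]]_d :=
  expmx ((- 'i * tau%:C) *: A).

Definition prodformula (d n Ups : nat) (Hg : 'I_n -> 'M[R[i]]_d)
  (a : 'I_Ups -> 'I_n -> R) (sigma : 'I_Ups -> 'S_n) (tau : R) : 'M[R[i]]_d :=
  mprod (fun u : 'I_Ups =>
    mprod (fun i : 'I_n => expiH (tau * a u (sigma u i)) (Hg (sigma u i)))).

Definition valid_formula (n Ups : nat) (a : 'I_Ups -> 'I_n -> R) (Abnd : R) : Prop :=
  (forall g, \sum_(u < Ups) a u g = 1) /\ (forall u g, `|a u g| <= Abnd).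

Definition has_order (d : nat) (p : nat) (S : R -> 'M[R[i]]_d)
  (H : 'M[R[i]]_d) : Prop :=
  exists (C delta : R), 0 < delta /\
    forall tau : R, `|tau| < delta ->
      opnorm (S tau - expiH tau H) <= C * `|tau| ^+ p.+1.

(* Each outer factor e^{-i (t/r) a H_g} is replaced by S'_g(t a/(r r'))^{r'},
   S'_g the inner formula over the Pauli terms c_i P_i of H_g. *)
Definition nested_circuit (NL nq NH Ups Ups' : nat) (NPg : 'I_NH -> nat)
  (c : forall g, 'I_(NPg g) -> R[i]) (s : forall g, 'I_(NPg g) -> pstring NL nq)
  (a : 'I_Ups -> 'I_NH -> R) (sigma : 'I_Ups -> 'S_NH)
  (b : forall g, 'I_Ups' -> 'I_(NPg g) -> R) (sigma' : forall g, 'I_Ups' -> 'S_(NPg g))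
  (t : R) (r : nat) (r' : 'I_Ups -> 'I_NH -> nat) : 'M[R[i]]_(dim NL nq) :=
  mpow (mprod (fun u : 'I_Ups => mprod (fun i : 'I_NH =>
     let g := sigma u i in
     mpow (prodformula (fun m : 'I_(NPg g) => c g m *: pauli_mx (s g m))
                       (b g) (sigma' g) (t * a u g / (r%:R * (r' u g)%:R)))
          (r' u g)))) r.

(* number of exponentials of single scaled Pauli strings in the circuit *)
Definition gate_count (NH Ups Ups' : nat) (NPg : 'I_NH -> nat) (r : nat)
  (r' : 'I_Ups -> 'I_NH -> nat) : nat :=
  r * \sum_(u < Ups) \sum_(g < NH) (r' u g * (Ups' * NPg g)).

Definition trotter_scale (Nind NH NP : nat) (cP t eps : R) (p : nat) : R :=
  Nind%:R * (NH%:R `^ (p%:R)^-1) * ((NP%:R * cP * t) `^ (1 + (p%:R)^-1))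
  / (eps `^ (p%:R)^-1).
Definition gate_scale (Nind NH NP : nat) (cP t eps : R) (p : nat) : R :=
  Nind%:R * NP%:R * ((NH%:R * NP%:R * cP * t) `^ (1 + (p%:R)^-1))
  / (eps `^ (p%:R)^-1).

End Defs.

(* Main.v *)
(** Write X for -i times the Hamiltonian and S(t) for the product formula, a
    product of exponentials exp(tY) of skew-Hermitian matrices Y.  Then
    S' = T S, where T(t) is a sum of terms Y conjugated by partial products,
    and the error S(t) - exp(tX) is governed by T - X.  Taylor expanding the
    conjugations from the inside out gives a polynomial of degree < p plus a
    remainder of size t^p times the sum of the norms of the p-fold nested
    commutators of the factors, because the outer unitaries do not enlarge the
    remainder.  The order condition forces the polynomial to be X, so the
    error of one step is at most t^(p+1) times that commutator sum.

    A term meets a nested commutator nontrivially only if it shares a site with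
    it, so each further commutator costs a factor of order |||H|||_1 and the
    sum is of order |||H|||_1^p ||H||_1.  Adding up r steps gives the Trotter
    number.  For the inner formulas the crude bound ||ad_Y|| <= 2||Y|| is enough:
    with the tight r, a single inner repetition already has total error
    O(eps), whence the gate count. *)
Require Import Defs.
From HB Require Import structures.
From mathcomp Require Import all_boot all_order all_algebra all_fingroup.
From mathcomp Require Import all_classical all_reals all_analysis.
From mathcomp Require Import complex.
From mathcomp Require Import ring lra.

Import Order.TTheory GRing.Theory Num.Theory numFieldNormedType.Exports.
Local Open Scope ring_scope.

(** * Euclidean norm, operator norm, adjoints and unitary matrices *)

Section OperatorNorm.
Local Open Scope complex_scope.
Set Implicit Arguments.
Unset Strict Implicit.
Variable R : realType.
Implicit Types z w : R[i].

Lemma csq_ge0 z : 0 <= csq z.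
Proof. by rewrite addr_ge0 ?sqr_ge0. Qed.

Lemma cabs_ge0 z : 0 <= cabs z.
Proof. exact: sqrtr_ge0. Qed.

Lemma sqr_cabs z : cabs z ^+ 2 = csq z.
Proof. by rewrite sqr_sqrtr ?csq_ge0. Qed.

Lemma cabs_normc z : cabs z = Normc.normc z.
Proof. by case: z. Qed.

Lemma cabsM z w : cabs (z * w) = cabs z * cabs w.
Proof. by rewrite !cabs_normc Normc.normcM. Qed.

Lemma cabsD z w : cabs (z + w) <= cabs z + cabs w.
Proof. by rewrite !cabs_normc; exact: (le_normcD z w). Qed.

Lemma cabs0 : cabs (0 : R[i]) = 0.
Proof. by rewrite cabs_normc Normc.normc0. Qed.

Lemma cabs_real (x : R) : cabs x%:C = `|x|.
Proof. by rewrite /cabs /csq /= expr0n /= addr0 sqrtr_sqr. Qed.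

Lemma cabs_sum (I : Type) (r : seq I) (P : pred I) (F : I -> R[i]) :
  cabs (\sum_(i <- r | P i) F i) <= \sum_(i <- r | P i) cabs (F i).
Proof.
elim/big_rec2: _ => [|i x y _ yx]; first by rewrite cabs0.
by apply: le_trans (cabsD _ _) _; rewrite lerD2l.
Qed.

Lemma normr_Re_le z : `|complex.Re z| <= cabs z.
Proof. by rewrite -sqrtr_sqr ler_sqrt ?csq_ge0// lerDl sqr_ge0. Qed.

Lemma normr_Im_le z : `|complex.Im z| <= cabs z.
Proof. by rewrite -sqrtr_sqr ler_sqrt ?csq_ge0// lerDr sqr_ge0. Qed.

(** Lagrange's identity: the double sum of the squares (x_i y_j - x_j y_i)^2 is twice the gap
    between the two sides. *)
Lemma cauchy_schwarz_sum n (x y : 'I_n -> R) :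
  (\sum_i x i * y i) ^+ 2 <= (\sum_i x i ^+ 2) * (\sum_i y i ^+ 2).
Proof.
have : 0 <= \sum_i \sum_j (x i * y j - x j * y i) ^+ 2.
  by apply: sumr_ge0 => i _; apply: sumr_ge0 => j _; exact: sqr_ge0.
have -> : \sum_i \sum_j (x i * y j - x j * y i) ^+ 2 =
  ((\sum_i x i ^+ 2) * (\sum_i y i ^+ 2) - (\sum_i x i * y i) ^+ 2) *+ 2.
  transitivity (\sum_i \sum_j (x i ^+ 2 * y j ^+ 2)
     - (\sum_i \sum_j (x i * y i) * (x j * y j)) *+ 2
     + \sum_i \sum_j (x j ^+ 2 * y i ^+ 2)).
    rewrite -sumrMnl -sumrB -big_split/=; apply: eq_bigr => i _.
    rewrite -sumrMnl -sumrB -big_split/=; apply: eq_bigr => j _; ring.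
  rewrite [X in _ + X = _]exchange_big/= expr2 !big_distrlr/=; ring.
by rewrite pmulrn_lge0// subr_ge0.
Qed.

Lemma sum_mul_le_sqrt n (x y : 'I_n -> R) :
  \sum_i x i * y i <= Num.sqrt (\sum_i x i ^+ 2) * Num.sqrt (\sum_i y i ^+ 2).
Proof.
have sx (z : 'I_n -> R) : 0 <= \sum_i z i ^+ 2.
  by apply: sumr_ge0 => i _; exact: sqr_ge0.
apply: le_trans (ler_norm _) _.
by rewrite -sqrtrM// -sqrtr_sqr ler_sqrt ?mulr_ge0// cauchy_schwarz_sum.
Qed.

Section Vectors.
Variable d : nat.
Implicit Types (u v : 'cV[R[i]]_d) (A B : 'M[R[i]]_d).

Lemma vnormE v : vnorm v = Num.sqrt (\sum_i cabs (v i 0) ^+ 2).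
Proof. by under [in RHS]eq_bigr do rewrite sqr_cabs. Qed.

Lemma vnorm_ge0 v : 0 <= vnorm v.
Proof. exact: sqrtr_ge0. Qed.

Lemma sqr_vnorm v : vnorm v ^+ 2 = \sum_i cabs (v i 0) ^+ 2.
Proof. by rewrite vnormE sqr_sqrtr// sumr_ge0// => i _; exact: sqr_ge0. Qed.

Lemma vnormD u v : vnorm (u + v) <= vnorm u + vnorm v.
Proof.
rewrite -(@ler_pXn2r _ 2)// ?nnegrE ?addr_ge0 ?vnorm_ge0//.
rewrite sqr_vnorm sqrrD !sqr_vnorm.
apply: (@le_trans _ _ (\sum_i (cabs (u i 0) + cabs (v i 0)) ^+ 2)).
  by apply: ler_sum => i _; rewrite mxE ler_pXn2r ?nnegrE ?addr_ge0 ?cabs_ge0 ?cabsD.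
under eq_bigr do rewrite sqrrD.
rewrite big_split/= lerD2r big_split/= lerD2l sumrMnl ler_pMn2r//.
by rewrite !vnormE; exact: sum_mul_le_sqrt.
Qed.

Lemma vnormZ (c : R[i]) v : vnorm (c *: v) = cabs c * vnorm v.
Proof.
rewrite -[cabs c]ger0_norm ?cabs_ge0// -sqrtr_sqr !vnormE -sqrtrM ?sqr_ge0//.
by congr Num.sqrt; rewrite mulr_sumr; apply: eq_bigr => i _; rewrite mxE cabsM exprMn.
Qed.

Lemma vnorm_eq0 v : vnorm v = 0 -> v = 0.
Proof.
move=> v0; apply/colP => i; rewrite mxE.
have /eqP := sqr_vnorm v.
rewrite v0 expr0n/= eq_sym psumr_eq0; last by move=> *; exact: sqr_ge0.
move=> /allP/(_ i); rewrite mem_index_enum => /(_ isT)/implyP/(_ isT).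
by rewrite sqrf_eq0 cabs_normc => /eqP/Normc.eq0_normc.
Qed.

Lemma vnorm0 : vnorm (0 : 'cV[R[i]]_d) = 0.
Proof.
by rewrite vnormE big1 ?sqrtr0// => i _; rewrite mxE cabs0 expr0n.
Qed.

(** The Frobenius norm of [A] serves as [K]; it makes the set in [opnorm] bounded above, so that its
    [sup] is meaningful. *)
Lemma vnorm_mulmx_bound A : exists K, forall v, vnorm (A *m v) <= K * vnorm v.
Proof.
exists (Num.sqrt (\sum_i (\sum_j cabs (A i j) ^+ 2))) => v.
have s0 i : 0 <= \sum_j cabs (A i j) ^+ 2.
  by rewrite sumr_ge0// => j _; exact: sqr_ge0.
have S0 : 0 <= \sum_i \sum_j cabs (A i j) ^+ 2 by apply: sumr_ge0.
rewrite -[vnorm v]ger0_norm ?vnorm_ge0// -sqrtr_sqr -sqrtrM//.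
rewrite vnormE ler_sqrt; last by rewrite mulr_ge0// sqr_ge0.
rewrite mulr_suml.
apply: ler_sum => i _; rewrite mxE sqr_vnorm.
apply: le_trans (cauchy_schwarz_sum _ _).
rewrite ler_pXn2r ?nnegrE ?cabs_ge0//; last first.
  by rewrite sumr_ge0// => j _; rewrite mulr_ge0 ?cabs_ge0.
by apply: le_trans (cabs_sum _ _ _) _; under eq_bigr do rewrite cabsM.
Qed.

(** [0 <= K] covers dimension 0, where no unit vector exists and [opnorm] is the [sup] of the empty
    set, namely 0. *)
Lemma opnorm_le A K : 0 <= K -> (forall v, vnorm (A *m v) <= K * vnorm v) ->
  opnorm A <= K.
Proof.
move=> K0 AK; rewrite /opnorm.
have [->|/set0P ne] := eqVneq [set vnorm (A *m v) | v in
   [set v : 'cV[R[i]]_d | vnorm v = 1]]%classic set0; first by rewrite sup0.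
apply: ge_sup => // _ [v /= v1 <-].
by have := AK v; rewrite v1 mulr1.
Qed.

Lemma vnorm_mulmx A v : vnorm (A *m v) <= opnorm A * vnorm v.
Proof.
have [/vnorm_eq0 ->|v0] := eqVneq (vnorm v) 0.
  by rewrite mulmx0 vnorm0 mulr0.
have vgt0 : 0 < vnorm v by rewrite lt_def v0 vnorm_ge0.
rewrite -ler_pdivrMr//.
have -> : vnorm (A *m v) / vnorm v = vnorm (A *m ((vnorm v)^-1%:C *: v)).
  rewrite -scalemxAr vnormZ cabs_real ger0_norm ?invr_ge0 ?vnorm_ge0//.
  by rewrite mulrC.
apply: ub_le_sup.
  have [K AK] := vnorm_mulmx_bound A.
  by exists K => _ [w /= w1 <-]; have := AK w; rewrite w1 mulr1.
exists ((vnorm v)^-1%:C *: v) => //=.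
by rewrite vnormZ cabs_real ger0_norm ?invr_ge0 ?vnorm_ge0// mulVf.
Qed.

Lemma opnorm_ge0 A : 0 <= opnorm A.
Proof.
rewrite /opnorm.
have [->|/set0P [_ [v /= v1 _]]] := eqVneq [set vnorm (A *m v) | v in
   [set v : 'cV[R[i]]_d | vnorm v = 1]]%classic set0; first by rewrite sup0.
by have := le_trans (vnorm_ge0 _) (vnorm_mulmx A v); rewrite v1 mulr1.
Qed.

Lemma opnormD A B : opnorm (A + B) <= opnorm A + opnorm B.
Proof.
apply: opnorm_le => [|v]; first by rewrite addr_ge0 ?opnorm_ge0.
rewrite mulmxDl mulrDl; apply: le_trans (vnormD _ _) _.
by rewrite lerD ?vnorm_mulmx.
Qed.

Lemma opnormM A B : opnorm (A * B) <= opnorm A * opnorm B.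
Proof.
apply: opnorm_le => [|v]; first by rewrite mulr_ge0 ?opnorm_ge0.
rewrite -mulmxE -mulmxA; apply: le_trans (vnorm_mulmx _ _) _.
by rewrite -mulrA ler_wpM2l ?opnorm_ge0 ?vnorm_mulmx.
Qed.

Lemma opnormZ (c : R[i]) A : opnorm (c *: A) <= cabs c * opnorm A.
Proof.
apply: opnorm_le => [|v]; first by rewrite mulr_ge0 ?opnorm_ge0 ?cabs_ge0.
by rewrite -scalemxAl vnormZ -mulrA ler_wpM2l ?cabs_ge0 ?vnorm_mulmx.
Qed.

Lemma opnormZr (x : R) A : 0 <= x -> opnorm (x%:C *: A) <= x * opnorm A.
Proof. by move=> x0; rewrite -{2}[x]ger0_norm// -cabs_real opnormZ. Qed.

Lemma opnorm0 : opnorm (0 : 'M[R[i]]_d) = 0.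
Proof.
apply/le_anti; rewrite opnorm_ge0 andbT; apply: opnorm_le => // v.
by rewrite mul0mx vnorm0 mul0r.
Qed.

Lemma opnormN A : opnorm (- A) = opnorm A.
Proof.
have le B : opnorm (- B) <= opnorm B.
  rewrite -scaleN1r; apply: le_trans (opnormZ _ _) _.
  by rewrite -[-1](rmorphN1 (real_complex R)) cabs_real normrN1 mul1r.
by apply/le_anti; rewrite le/=; have := le (- A); rewrite opprK.
Qed.

Lemma opnormB A B : opnorm (A - B) <= opnorm A + opnorm B.
Proof. by rewrite -(opnormN B) opnormD. Qed.

Lemma opnorm1_le : opnorm (1 : 'M[R[i]]_d) <= 1.
Proof. by apply: opnorm_le => // v; rewrite mul1mx mul1r. Qed.

Lemma opnorm_sum (I : Type) (r : seq I) (P : pred I) (F : I -> 'M[R[i]]_d) :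
  opnorm (\sum_(i <- r | P i) F i) <= \sum_(i <- r | P i) opnorm (F i).
Proof.
elim/big_rec2: _ => [|i x y _ yx]; first by rewrite opnorm0.
by apply: le_trans (opnormD _ _) _; rewrite lerD2l.
Qed.

Lemma opnormM3 A B C : opnorm A <= 1 -> opnorm C <= 1 ->
  opnorm (A * B * C) <= opnorm B.
Proof.
move=> A1 C1; apply: le_trans (opnormM _ _) _.
apply: le_trans (ler_piMr (opnorm_ge0 _) C1) _.
by apply: le_trans (opnormM _ _) _; exact: (ler_piMl (opnorm_ge0 _) A1).
Qed.

Lemma opnormX A n : opnorm (A ^+ n) <= opnorm A ^+ n.
Proof.
elim: n => [|n IH]; first exact: opnorm1_le.
rewrite !exprS; apply: le_trans (opnormM _ _) _.
by rewrite ler_wpM2l ?opnorm_ge0.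
Qed.

Lemma vnorm_delta (j : 'I_d) : vnorm (delta_mx j 0 : 'cV[R[i]]_d) = 1.
Proof.
rewrite vnormE (bigD1 j)//= big1 ?addr0 => [|i ij].
  by rewrite mxE !eqxx cabs_normc Normc.normc1 expr1n sqrtr1.
by rewrite mxE (negPf ij) cabs0 expr0n.
Qed.

(** Column [j] of [A] is the image of a unit vector. This turns norm bounds into entrywise
    convergence and makes the norm definite. *)
Lemma entry_le_opnorm A i j : cabs (A i j) <= opnorm A.
Proof.
have := vnorm_mulmx A (delta_mx j 0); rewrite vnorm_delta mulr1.
apply: le_trans; rewrite -colE vnormE.
rewrite -[cabs _]ger0_norm ?cabs_ge0// -sqrtr_sqr.
have s0 (P : pred 'I_d) : 0 <= \sum_(k | P k) cabs (col j A k 0) ^+ 2.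
  by rewrite sumr_ge0// => *; exact: sqr_ge0.
rewrite ler_sqrt// (bigD1 i)//= mxE.
by rewrite lerDl.
Qed.

Lemma opnorm_eq0 A : opnorm A <= 0 -> A = 0.
Proof.
move=> A0; apply/matrixP => i j; rewrite mxE.
have := le_trans (entry_le_opnorm A i j) A0.
by rewrite le_eqVlt ltNge cabs_ge0 orbF cabs_normc => /eqP/Normc.eq0_normc.
Qed.

(** The inner product of C^d regarded as R^(2d): pairing a matrix curve with vectors gives a real
    function, to which the scalar mean value theorem applies. *)
Definition rdot u v : R :=
  \sum_i (complex.Re (u i 0) * complex.Re (v i 0)
        + complex.Im (u i 0) * complex.Im (v i 0)).

Lemma rdot_le u v : rdot u v <= vnorm u * vnorm v.
Proof.
rewrite !vnormE; apply: le_trans (sum_mul_le_sqrt _ _).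
apply: ler_sum => i _.
case: (u i 0) (v i 0) => [a b] [a' b'] /=.
apply: le_trans (ler_norm _) _.
rewrite -cabsM -sqrtr_sqr ler_sqrt ?csq_ge0//.
have -> : a * a' + b * b' = complex.Re ((a +i* b) * conjc (a' +i* b')).
  by rewrite /= mulrN opprK.
have -> : csq ((a +i* b) * (a' +i* b')) = csq ((a +i* b) * conjc (a' +i* b')).
  rewrite /csq /=; ring.
by rewrite lerDl sqr_ge0.
Qed.

Lemma rdot_self v : rdot v v = vnorm v ^+ 2.
Proof.
by rewrite sqr_vnorm; apply: eq_bigr => i _; rewrite sqr_cabs /csq -!expr2.
Qed.

Lemma adjmxM A B : adjmx (A * B) = adjmx B * adjmx A.
Proof.
apply/matrixP => i j; rewrite -!mulmxE !mxE rmorph_sum /=.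
by apply: eq_bigr => k _; rewrite !mxE rmorphM mulrC.
Qed.

Lemma adjmxD A B : adjmx (A + B) = adjmx A + adjmx B.
Proof. by apply/matrixP => i j; rewrite !mxE rmorphD. Qed.

Lemma adjmxN A : adjmx (- A) = - adjmx A.
Proof. by apply/matrixP => i j; rewrite !mxE rmorphN. Qed.

Lemma adjmx_is_zmod : zmod_morphism (@adjmx R d).
Proof. by move=> A B; rewrite adjmxD adjmxN. Qed.
HB.instance Definition _ := GRing.isZmodMorphism.Build 'M[R[i]]_d 'M[R[i]]_d
  (@adjmx R d) adjmx_is_zmod.

Lemma adjmxZ (c : R[i]) A : adjmx (c *: A) = conjc c *: adjmx A.
Proof. by apply/matrixP => i j; rewrite !mxE rmorphM. Qed.

Lemma adjmxK A : adjmx (adjmx A) = A.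
Proof. by apply/matrixP => i j; rewrite !mxE conjcK. Qed.

Lemma adjmx1 : adjmx (1 : 'M[R[i]]_d) = 1.
Proof. by apply/matrixP => i j; rewrite !mxE eq_sym rmorph_nat. Qed.

Definition unitary A := adjmx A * A = 1.

Lemma unitaryV A : unitary A -> A * adjmx A = 1.
Proof. exact: mulmx1C. Qed.

Lemma unitary_adj A : unitary A -> unitary (adjmx A).
Proof. by move=> AU; rewrite /unitary adjmxK; exact: unitaryV. Qed.

Lemma unitaryM A B : unitary A -> unitary B -> unitary (A * B).
Proof.
by move=> AU BU; rewrite /unitary adjmxM mulrA -[_ * A]mulrA AU mulr1.
Qed.

Lemma unitary1 : unitary 1.
Proof. by rewrite /unitary adjmx1 mulr1. Qed.

(** Written as the product v^* v, the squared norm of [A *m v] exposes [adjmx A *m A], which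
    unitarity cancels. *)
Lemma sqr_vnorm_mulmx v :
  ((vnorm v ^+ 2)%:C)%C = (map_mx conjc v^T *m v) 0 0.
Proof.
rewrite sqr_vnorm rmorph_sum mxE; apply: eq_bigr => i _.
rewrite !mxE sqr_cabs /csq; case: (v i 0) => a b.
by apply/eqP; rewrite eq_complex /=; apply/andP; split; apply/eqP; ring.
Qed.

Lemma unitary_opnorm A : unitary A -> opnorm A <= 1.
Proof.
move=> AU; apply: opnorm_le => // v; rewrite mul1r.
suff e : vnorm (A *m v) ^+ 2 = vnorm v ^+ 2.
  by rewrite -(@ler_pXn2r _ 2)// ?nnegrE ?vnorm_ge0// e.
apply: (@complexI R); rewrite !sqr_vnorm_mulmx trmx_mul map_mxM.
have -> : map_mx conjc A^T = adjmx A by apply/matrixP => i j; rewrite !mxE.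
have -> : map_mx conjc v^T *m adjmx A *m (A *m v) =
          map_mx conjc v^T *m ((adjmx A *m A) *m v) by rewrite !mulmxA.
by have -> : adjmx A *m A = 1%:M by []; rewrite mul1mx.
Qed.

End Vectors.
End OperatorNorm.

(** * Entrywise derivatives of matrix curves and a mean value inequality *)

Section MatrixDerivative.
Local Open Scope complex_scope.
Set Implicit Arguments.
Unset Strict Implicit.
Variables (R : realType) (d : nat).
Local Notation M := 'M[R[i]]_d.
Implicit Types (f g : R -> M) (A B : M).

Lemma is_derive1M (f g : R -> R) (x df dg : R) :
  is_derive x 1 f df -> is_derive x 1 g dg ->
  is_derive x 1 (fun t => f t * g t) (df * g x + f x * dg).
Proof.
move=> Df Dg; apply: is_derive_eq (is_deriveM Df Dg) _.
by rewrite /GRing.scale/= addrC mulrC.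
Qed.

Lemma is_derive1_sum n (f : 'I_n -> R -> R) (x : R) (df : 'I_n -> R) :
  (forall i, is_derive x 1 (f i) (df i)) ->
  is_derive x 1 (fun t => \sum_i f i t) (\sum_i df i).
Proof. by move=> Df; have := is_derive_sum Df; rewrite fct_sumE. Qed.

Lemma is_derive1_shift (f : R -> R) (x k df : R) :
  is_derive (x + k) 1 f df -> is_derive x 1 (fun t => f (t + k)) df.
Proof.
move=> Df; rewrite -[df]mulr1.
exact: (@is_derive1_comp _ f (shift k) x df 1 Df (is_derive_shift _ _ _)).
Qed.

Lemma is_derive1Xn (n : nat) (x : R) :
  is_derive x 1 (fun t : R => t ^+ n) (n%:R * x ^+ n.-1).
Proof.
have := is_deriveX n (is_derive_id x (1 : R)); rewrite exprfctE.
by move=> Dx; apply: is_derive_eq Dx _; rewrite /GRing.scale/= mulr1.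
Qed.

(** Encoded by real and imaginary parts of the entries, so that only real functions of a real
    variable are differentiated. *)
Definition mderiv f (x : R) A := forall i j,
  is_derive x 1 (fun t => complex.Re (f t i j)) (complex.Re (A i j)) /\
  is_derive x 1 (fun t => complex.Im (f t i j)) (complex.Im (A i j)).

Lemma mderiv_eq f x A B : mderiv f x A -> A = B -> mderiv f x B.
Proof. by move=> ? <-. Qed.

Lemma mderiv_ext f g x A : f =1 g -> mderiv f x A -> mderiv g x A.
Proof. by move=> /funext ->. Qed.

Lemma mderiv_cst A x : mderiv (fun=> A) x 0.
Proof. by move=> i j; rewrite mxE /=; split; exact: is_derive_cst. Qed.

Lemma mderivD f g x A B : mderiv f x A -> mderiv g x B ->
  mderiv (fun t => f t + g t) x (A + B).
Proof.
move=> Df Dg i j; have [a b] := Df i j; have [a' b'] := Dg i j.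
split; under eq_fun do rewrite mxE raddfD/=; rewrite mxE raddfD/=;
  exact: is_deriveD.
Qed.

Lemma mderivN f x A : mderiv f x A -> mderiv (fun t => - f t) x (- A).
Proof.
move=> Df i j; have [a b] := Df i j.
split; under eq_fun do rewrite mxE raddfN/=; rewrite mxE raddfN/=;
  exact: is_deriveN.
Qed.

Lemma mderivB f g x A B : mderiv f x A -> mderiv g x B ->
  mderiv (fun t => f t - g t) x (A - B).
Proof. by move=> Df Dg; apply: mderivD => //; exact: mderivN. Qed.

Lemma mderiv_sum n (f : 'I_n -> R -> M) x (A : 'I_n -> M) :
  (forall k, mderiv (f k) x (A k)) ->
  mderiv (fun t => \sum_k f k t) x (\sum_k A k).
Proof.
elim: n f A => [|n IH] f A Df.
  rewrite big_ord0; apply: mderiv_ext (mderiv_cst 0 x) => t.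
  by rewrite big_ord0.
rewrite big_ord_recr/=.
apply: (mderiv_ext (f := fun t => \sum_(k < n) f (widen_ord (leqnSn n) k) t
   + f ord_max t)); first by move=> t; rewrite big_ord_recr.
by apply: mderivD (Df _); exact: IH.
Qed.

Lemma ReM (z w : R[i]) : complex.Re (z * w) =
  complex.Re z * complex.Re w - complex.Im z * complex.Im w.
Proof. by case: z w => ? ? []. Qed.

Lemma ImM (z w : R[i]) : complex.Im (z * w) =
  complex.Re z * complex.Im w + complex.Im z * complex.Re w.
Proof. by case: z w => ? ? []. Qed.

Lemma Re_mulmx m n p (A : 'M[R[i]]_(m, n)) (B : 'M[R[i]]_(n, p)) i j :
  complex.Re ((A *m B) i j) = \sum_k (complex.Re (A i k) * complex.Re (B k j)
    - complex.Im (A i k) * complex.Im (B k j)).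
Proof. by rewrite mxE raddf_sum; apply: eq_bigr => k _; rewrite /= ReM. Qed.

Lemma Im_mulmx m n p (A : 'M[R[i]]_(m, n)) (B : 'M[R[i]]_(n, p)) i j :
  complex.Im ((A *m B) i j) = \sum_k (complex.Re (A i k) * complex.Im (B k j)
    + complex.Im (A i k) * complex.Re (B k j)).
Proof. by rewrite mxE raddf_sum; apply: eq_bigr => k _; rewrite /= ImM. Qed.

Lemma mderivM f g x A B : mderiv f x A -> mderiv g x B ->
  mderiv (fun t => f t * g t) x (A * g x + f x * B).
Proof.
move=> Df Dg i j; split.
- under eq_fun do rewrite -mulmxE Re_mulmx.
  rewrite mxE raddfD/= -!mulmxE !Re_mulmx -big_split/=.
  apply: is_derive1_sum => k; have [a b] := Df i k; have [a' b'] := Dg k j.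
  apply: is_derive_eq (is_deriveB (is_derive1M a a') (is_derive1M b b')) _; ring.
- under eq_fun do rewrite -mulmxE Im_mulmx.
  rewrite mxE raddfD/= -!mulmxE !Im_mulmx -big_split/=.
  apply: is_derive1_sum => k; have [a b] := Df i k; have [a' b'] := Dg k j.
  apply: is_derive_eq (is_deriveD (is_derive1M a b') (is_derive1M b a')) _; ring.
Qed.

Lemma mderivZ (h : R -> R) (x dh : R) A : is_derive x 1 h dh ->
  mderiv (fun t => (h t)%:C *: A) x (dh%:C *: A).
Proof.
move=> Dh i j.
have Z (y : R) (z : R[i]) : (complex.Re (y%:C * z) = y * complex.Re z) *
   (complex.Im (y%:C * z) = y * complex.Im z).
  by case: z => a b; rewrite /= !mul0r subr0 addr0.
by split; under eq_fun do rewrite mxE Z/=; rewrite mxE Z;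
  apply: is_derive_eq (is_derive1M Dh (is_derive_cst _ _ _)) _;
  rewrite /= mulr0 addr0.
Qed.

Lemma mderiv_shift f x k A : mderiv f (x + k) A ->
  mderiv (fun t => f (t + k)) x A.
Proof.
move=> Df i j; have [a b] := Df i j.
by split; [exact: (is_derive1_shift a)|exact: (is_derive1_shift b)].
Qed.

Lemma mderiv_adjmx f x A : mderiv f x A ->
  mderiv (fun t => adjmx (f t)) x (adjmx A).
Proof.
move=> Df i j; have [a b] := Df j i.
have E (z : R[i]) : (complex.Re z^* = complex.Re z) *
   (complex.Im z^* = - complex.Im z) by case: z.
split; under eq_fun do rewrite mxE E; rewrite mxE E//.
exact: is_deriveN.
Qed.

(* Mean value inequality, obtained by pairing [f] with the vectors [w] and
   [v] for a vector [v] of norm 1 and [w = (f t - f 0) v]. *)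
Lemma mderiv_le f (f' : R -> M) (h h' : R -> R) (t : R) : 0 <= t ->
  (forall s, mderiv f s (f' s)) -> (forall s : R, is_derive s 1 h (h' s)) ->
  (forall s, 0 <= s <= t -> opnorm (f' s) <= h' s) ->
  opnorm (f t - f 0) <= h t - h 0.
Proof.
move=> t0 Df Dh le.
have vle v : vnorm ((f t - f 0) *m v) <= (h t - h 0) * vnorm v.
  set w := (f t - f 0) *m v.
  pose phi s := rdot w (f s *m v).
  pose phi' s := rdot w (f' s *m v).
  have Dphi (s : R) : is_derive s 1 phi (phi' s).
    apply: is_derive1_sum => i.
    have cM (c : R) (k : R -> R) (dk : R) : is_derive s 1 k dk ->
        is_derive s 1 (fun t => c * k t) (c * dk).
      move=> Dk; apply: is_derive_eq
        (is_derive1M (is_derive_cst c s (1 : R)) Dk) _.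
      by rewrite mul0r add0r.
    have cM' (c : R) (k : R -> R) (dk : R) : is_derive s 1 k dk ->
        is_derive s 1 (fun t => k t * c) (dk * c).
      move=> Dk; apply: is_derive_eq
        (is_derive1M Dk (is_derive_cst c s (1 : R))) _.
      by rewrite mulr0 addr0.
    apply: is_deriveD; apply: cM.
      under eq_fun do rewrite Re_mulmx.
      rewrite Re_mulmx; apply: is_derive1_sum => k.
      have [a b] := Df s i k.
      by apply: is_deriveB; exact: cM'.
    under eq_fun do rewrite Im_mulmx.
    rewrite Im_mulmx; apply: is_derive1_sum => k.
    have [a b] := Df s i k.
    by apply: is_deriveD; exact: cM'.
  have Dpsi (s : R) : is_derive s 1 (fun s => h s * (vnorm w * vnorm v) - phi s)
      (h' s * (vnorm w * vnorm v) - phi' s).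
    apply: is_deriveB (Dphi s).
    apply: is_derive_eq (is_derive1M (Dh s) (is_derive_cst _ _ _)) _.
    by rewrite mulr0 addr0.
  (* By Cauchy-Schwarz and the bound on [f'], the function [h s * (vnorm w * vnorm v) - phi s] has
     non-negative derivative on [0, t]. *)
  have [|c /itvP cI] := MVT_segment t0 (fun s _ => Dpsi s).
    by apply: derivable_within_continuous => s _; exact: ex_derive.
  have nn : 0 <= (h' c * (vnorm w * vnorm v) - phi' c) * (t - 0).
    rewrite mulr_ge0 ?subr_ge0 ?subr0//; apply: le_trans (rdot_le _ _) _.
    rewrite mulrCA ler_wpM2l ?vnorm_ge0//.
    apply: le_trans (vnorm_mulmx _ _) _.
    by rewrite ler_wpM2r ?vnorm_ge0// le// !cI.
  move=> E; rewrite -E in nn.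
  have {nn E} : phi t - phi 0 <= (h t - h 0) * (vnorm w * vnorm v).
    rewrite mulrBl; lra.
  (* For this [w] the increment of [phi] is |w|^2, so one factor |w| cancels. *)
  have -> : phi t - phi 0 = vnorm w * vnorm w.
    rewrite -expr2 -rdot_self /phi /rdot -sumrB; apply: eq_bigr => i _.
    have -> : w i 0 = (f t *m v) i 0 - (f 0 *m v) i 0.
      by rewrite /w mulmxBl [LHS]mxE [X in _ + X]mxE.
    rewrite !raddfB/=; ring.
  rewrite mulrCA.
  (* If [w = 0] nothing can be cancelled, and [h 0 <= h t] is read off from [h' >= 0], which the
     norm bound forces. *)
  have [->|w0] := eqVneq (vnorm w) 0.
    move=> _; rewrite mulr_ge0 ?vnorm_ge0//.
    have [|c' /itvP cI'] := MVT_segment t0 (fun s _ => Dh s).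
      by apply: derivable_within_continuous => s _; exact: ex_derive.
    move=> ->; rewrite mulr_ge0 ?subr0//.
    by apply: le_trans (opnorm_ge0 _) (le _ _); rewrite !cI'.
  by rewrite ler_pM2l// lt_def w0 vnorm_ge0.
apply: opnorm_le => //.
have [|c' /itvP cI'] := MVT_segment t0 (fun s _ => Dh s).
  by apply: derivable_within_continuous => s _; exact: ex_derive.
move=> ->; rewrite mulr_ge0 ?subr0//.
by apply: le_trans (opnorm_ge0 _) (le _ _); rewrite !cI'.
Qed.

(** The comparison function is [K / n.+1%:R * t ^+ n.+1]; its denominator is dropped at the end. *)
Lemma mderiv_leX f (f' : R -> M) (K : R) (n : nat) (t : R) : 0 <= t ->
  (forall s, mderiv f s (f' s)) ->
  (forall s, 0 <= s <= t -> opnorm (f' s) <= K * s ^+ n) ->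
  opnorm (f t - f 0) <= K * t ^+ n.+1.
Proof.
move=> t0 Df le.
have K0 : 0 <= K * t ^+ n.
  by apply: le_trans (opnorm_ge0 _) (le t _); rewrite t0 lexx.
have Dh (s : R) : is_derive s 1 (fun t : R => K / n.+1%:R * t ^+ n.+1) (K * s ^+ n).
  apply: is_derive_eq
    (is_derive1M (is_derive_cst (K / n.+1%:R) s (1 : R)) (is_derive1Xn n.+1 s)) _.
  by rewrite mul0r add0r/= mulrA divfK ?pnatr_eq0.
apply: le_trans (mderiv_le t0 Df Dh le) _.
rewrite expr0n/= mulr0 subr0 mulrAC ler_piMr ?invf_le1 ?ltr0n ?ler1n//.
by rewrite exprSr mulrA mulr_ge0.
Qed.

(** The source of the exponential identities below: each relates two values of a curve whose
    derivative cancels. *)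
Lemma mderiv0_cst f : (forall s, mderiv f s 0) ->
  forall t, 0 <= t -> f t = f 0.
Proof.
move=> Df t t0; apply/eqP; rewrite -subr_eq0; apply/eqP/opnorm_eq0.
have := mderiv_leX (K := 0) (n := 0) t0 Df; rewrite !mul0r; apply => s _.
by rewrite opnorm0 mul0r.
Qed.

End MatrixDerivative.

(** * The matrix exponential as a one-parameter group *)

Section MatrixExponential.
Local Open Scope classical_set_scope.
Local Open Scope ring_scope.
Local Open Scope complex_scope.
Set Implicit Arguments.
Unset Strict Implicit.
Variables (R : realType) (d : nat).
Local Notation M := 'M[R[i]]_d.
Implicit Types (A B X Y : M).

Lemma mpowE A n : mpow A n = A ^+ n.
Proof. by elim: n => //= n IH; rewrite /mpow/= -/(mpow A n) IH exprS. Qed.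

Lemma exprmxZ (c : R[i]) X n : (c *: X) ^+ n = c ^+ n *: X ^+ n.
Proof.
elim: n => [|n IH]; first by rewrite !expr0 scale1r.
by rewrite !exprS IH -!mulmxE -scalemxAl -scalemxAr scalerA.
Qed.

Section RealPart.
(* [part] stands for either of [Re] and [Im]. *)
Variable part : R[i] -> R.
Hypothesis partD : {morph part : z w / z + w}.
Hypothesis part0 : part 0 = 0.
Hypothesis partZ : forall (x : R) z, part (x%:C * z) = x * part z.
Hypothesis part_le : forall z, `|part z| <= cabs z.

(** The choice [B n = X ^+ n] gives the exponential series of [X], and [B n = X ^+ n.+1] its
    term-by-term derivative. *)
Definition pcoef (B : nat -> M) i j : R^nat := fun n => part (B n i j) / n`!%:R.

Lemma cvg_pcoef (B : nat -> M) (C K : R) i j x : 0 <= C -> 0 <= K ->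
  (forall n, opnorm (B n) <= C * K ^+ n) -> cvgn (pseries (pcoef B i j) x).
Proof.
move=> C0 K0 BC; apply: normed_cvg.
apply: (@series_le_cvg _ _ (C *: exp_coeff (K * `|x|))) => [n|n|n|].
- exact: normr_ge0.
- by rewrite /GRing.scale/= mulr_ge0// divr_ge0 ?exprn_ge0 ?mulr_ge0.
- rewrite /GRing.scale/= /pcoef !normrM normfV normr_nat normrX.
  rewrite /exp_coeff/= exprMn -[_ *: _]/(C * _) !mulrA mulrAC.
  rewrite ler_wpM2r ?invr_ge0// ler_wpM2r ?exprn_ge0//.
  apply: le_trans (part_le _) _; apply: le_trans (entry_le_opnorm _ _ _) _.
  exact: BC.
- exact/is_cvg_seriesZ/is_cvg_series_exp_coeff.
Qed.

Lemma pseries_pcoef (B : nat -> M) i j x N : pseries (pcoef B i j) x N =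
  part ((\sum_(n < N) ((n`!)%:R^-1 *: (x%:C ^+ n *: B n))) i j).
Proof.
rewrite /pseries /series/= big_mkord summxE.
rewrite (big_morph part partD part0); apply: eq_bigr => n _.
have -> : (n`!%:R : R[i])^-1 = ((n`!%:R : R)^-1)%:C.
  by rewrite fmorphV rmorph_nat.
by rewrite !mxE partZ -rmorphXn partZ /pcoef; ring.
Qed.

Lemma pcoef_diffs (B : nat -> M) i j :
  pseries_diffs (pcoef B i j) = pcoef (fun n => B n.+1) i j.
Proof.
apply/funext => n; rewrite /pseries_diffs /pcoef factS natrM.
by rewrite mulrCA invfM mulVKf ?pnatr_eq0.
Qed.

Lemma exp_partialE X x N : exp_partial (x%:C *: X) N =
  \sum_(n < N) ((n`!)%:R^-1 *: (x%:C ^+ n *: X ^+ n)).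
Proof. by apply: eq_bigr => n _; rewrite mpowE exprmxZ. Qed.

Lemma mul_exp_partial X x N : X * exp_partial (x%:C *: X) N =
  \sum_(n < N) ((n`!)%:R^-1 *: (x%:C ^+ n *: X ^+ n.+1)).
Proof.
rewrite exp_partialE; elim: N => [|N IH]; first by rewrite !big_ord0 mulr0.
rewrite !big_ord_recr/= mulrDr IH; congr (_ + _).
by rewrite -mulmxE -!scalemxAr mulmxE -exprS.
Qed.

Lemma opnorm_powD X k n : opnorm (X ^+ (n + k)) <= opnorm X ^+ k * opnorm X ^+ n.
Proof. by rewrite -exprD addnC; exact: opnormX. Qed.

Lemma cvg_exp_pcoef X i j x :
  cvgn (pseries (pcoef (fun n => X ^+ n) i j) x).
Proof.
apply: (@cvg_pcoef _ 1 (opnorm X)) => // [|n]; first exact: opnorm_ge0.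
by rewrite mul1r opnormX.
Qed.

Lemma cvg_exp_partial X i j x :
  (fun N => part (exp_partial (x%:C *: X) N i j)) @ \oo -->
  limn (pseries (pcoef (fun n => X ^+ n) i j) x).
Proof.
under eq_fun do rewrite exp_partialE -pseries_pcoef.
exact: cvg_exp_pcoef.
Qed.

Lemma is_derive_exp_part X i j (x : R) :
  is_derive x 1 (fun x => limn (pseries (pcoef (fun n => X ^+ n) i j) x))
    (limn (pseries (pcoef (fun n => X ^+ n.+1) i j) x)).
Proof.
rewrite -pcoef_diffs.
(* Term-by-term differentiation asks for convergence of the series and its first two formal
   derivatives at a point of modulus above |x|; here |x| + 1. *)
apply: (@pseries_snd_diffs R _ (`|x| + 1)); rewrite ?pcoef_diffs.
- exact: cvg_exp_pcoef.
- apply: (@cvg_pcoef _ (opnorm X ^+ 1) (opnorm X));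
    rewrite ?exprn_ge0 ?opnorm_ge0// => n.
  by rewrite -[n.+1]addn1 opnorm_powD.
- apply: (@cvg_pcoef _ (opnorm X ^+ 2) (opnorm X));
    rewrite ?exprn_ge0 ?opnorm_ge0// => n.
  by rewrite -[n.+2]addn2 opnorm_powD.
- by rewrite [ltRHS]ger0_norm ?addr_ge0// ltrDl.
Qed.

End RealPart.

Lemma ReD : {morph @complex.Re R : z w / z + w}.
Proof. by case=> ? ? []. Qed.

Lemma ImD : {morph @complex.Im R : z w / z + w}.
Proof. by case=> ? ? []. Qed.

Lemma ReZ (x : R) (z : R[i]) : complex.Re (x%:C * z) = x * complex.Re z.
Proof. by rewrite ReM/= mul0r subr0. Qed.

Lemma ImZ (x : R) (z : R[i]) : complex.Im (x%:C * z) = x * complex.Im z.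
Proof. by rewrite ImM/= mul0r addr0. Qed.

Definition cvgmx (u : nat -> M) A := forall i j,
  (fun N => complex.Re (u N i j)) @ \oo --> complex.Re (A i j) /\
  (fun N => complex.Im (u N i j)) @ \oo --> complex.Im (A i j).

Lemma cvgmx_exp X x : cvgmx (exp_partial (x%:C *: X)) (expmx (x%:C *: X)).
Proof.
move=> i j; rewrite mxE/=.
have a := @cvg_exp_partial _ ReD erefl ReZ (@normr_Re_le R) X i j x.
have b := @cvg_exp_partial _ ImD erefl ImZ (@normr_Im_le R) X i j x.
by split; [rewrite (cvg_lim _ a)|rewrite (cvg_lim _ b)].
Qed.

Lemma cvg_sum n (u : 'I_n -> R^nat) (l : 'I_n -> R) :
  (forall k, u k @ \oo --> l k) ->
  (fun N => \sum_k u k N) @ \oo --> \sum_k l k.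
Proof.
move=> ul; apply: cvg_big => //; exact: add_continuous.
Qed.

Lemma cvgmxMl X u A : cvgmx u A -> cvgmx (fun N => X * u N) (X * A).
Proof.
move=> uA i j; split; rewrite -mulmxE.
- under eq_fun do rewrite Re_mulmx.
  rewrite Re_mulmx; apply: cvg_sum => k; have [a b] := uA k j.
  by apply: cvgB; apply: cvgMr.
- under eq_fun do rewrite Im_mulmx.
  rewrite Im_mulmx; apply: cvg_sum => k; have [a b] := uA k j.
  by apply: cvgD; apply: cvgMr.
Qed.

(** Term-by-term differentiation yields the sum of x^n X^(n+1) / n!, whose partial sums are [X]
    times those of the exponential; left multiplication passes to the limit. *)
Lemma mderiv_exp X x : mderiv (fun x => expmx (x%:C *: X)) x (X * expmx (x%:C *: X)).
Proof.
have D (part : R[i] -> R) (pD : {morph part : z w / z + w}) (p0 : part 0 = 0)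
   (pZ : forall (x : R) z, part (x%:C * z) = x * part z)
   (pl : forall z, `|part z| <= cabs z) i j
   (pE : forall x, part (expmx (x%:C *: X) i j) =
      limn (fun N => part (exp_partial (x%:C *: X) N i j))) :
  (fun N => part ((X * exp_partial (x%:C *: X) N) i j)) @ \oo -->
     part ((X * expmx (x%:C *: X)) i j) ->
  is_derive x 1 (fun t => part (expmx (t%:C *: X) i j))
    (part ((X * expmx (x%:C *: X)) i j)).
  move=> lX.
  have -> : (fun t => part (expmx (t%:C *: X) i j)) =
      (fun t => limn (pseries (pcoef part (fun n => X ^+ n) i j) t)).
    apply/funext => t; rewrite pE; apply: cvg_lim => //.
    exact: cvg_exp_partial.
  apply: is_derive_eq (is_derive_exp_part pl X i j x) _.
  apply: cvg_lim => //.
  suff -> : pseries (pcoef part (fun n => X ^+ n.+1) i j) x =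
    (fun N => part ((X * exp_partial (x%:C *: X) N) i j)) by [].
  by apply/funext => N; rewrite pseries_pcoef// mul_exp_partial.
have c := cvgmxMl X (cvgmx_exp X x).
move=> i j; have [a b] := c i j; split.
- apply: D a => //; [exact: ReD|exact: ReZ|exact: normr_Re_le|].
  by move=> t; rewrite mxE.
- apply: D b => //; [exact: ImD|exact: ImZ|exact: normr_Im_le|].
  by move=> t; rewrite mxE.
Qed.

Lemma expmx0 : expmx (0 : M) = 1.
Proof.
(* The empty partial sum is 0, so only the sums with at least one term equal 1, and the limit is
   taken along the shifted sequence. *)
have E N : exp_partial (0 : M) N.+1 = 1.
  rewrite /exp_partial big_ord_recl big1 => [|n _].
    by rewrite mpowE expr0 fact0 invr1 scale1r addr0.
  by rewrite mpowE exprS mul0r scaler0.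
apply/matrixP => i j; rewrite mxE.
have lc (part : R[i] -> R) :
    limn (fun N => part (exp_partial (0 : M) N i j)) = part ((1 : M) i j).
  apply: cvg_lim => //; rewrite -cvg_shiftS; under eq_fun do rewrite E.
  exact: cvg_cst.
by rewrite !lc; case: ((1 : M) i j).
Qed.

Definition skew X := adjmx X = - X.

Lemma skewZ (x : R) X : skew X -> skew (x%:C *: X).
Proof. by move=> sX; rewrite /skew adjmxZ conjc_real sX scalerN. Qed.

Definition mexp X (t : R) : M := expmx (t%:C *: X).

Lemma mexp0 X : mexp X 0 = 1.
Proof. by rewrite /mexp scale0r expmx0. Qed.

Lemma mexpZ X (x t : R) : mexp (x%:C *: X) t = mexp X (t * x).
Proof. by rewrite /mexp scalerA -rmorphM. Qed.

Lemma mderiv_mexp X t : mderiv (mexp X) t (X * mexp X t).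
Proof. exact: mderiv_exp. Qed.

(** Since X^* = -X, the left side has zero derivative in [s], and at [s = 0] it is the right side.
    Taking [t = 0] gives unitarity, [t = - s] negative times, and general [t] the group law. *)
Lemma mexp_shift_cst X t s : skew X -> 0 <= s ->
  adjmx (mexp X s) * mexp X (s + t) = mexp X t.
Proof.
move=> sX s0.
transitivity (adjmx (mexp X 0) * mexp X (0 + t)); last first.
  by rewrite mexp0 adjmx1 mul1r add0r.
apply: (mderiv0_cst (f := fun s => adjmx (mexp X s) * mexp X (s + t))) s0 => r.
apply: mderiv_eq (mderivM (mderiv_adjmx (mderiv_mexp X r))
   (mderiv_shift (mderiv_mexp X (r + t)))) _.
by rewrite adjmxM sX mulrN mulNr mulrA addrC subrr.
Qed.

Lemma mexp_unitary X t : skew X -> unitary (mexp X t).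
Proof.
move=> sX.
have pos s : 0 <= s -> unitary (mexp X s).
  by move=> s0; have := mexp_shift_cst 0 sX s0; rewrite mexp0 addr0.
have [/pos//|t0] := leP 0 t.
have Nt0 : 0 <= - t by rewrite oppr_ge0 ltW.
have := mexp_shift_cst t sX Nt0; rewrite addNr mexp0 mulr1 => <-.
exact/unitary_adj/pos.
Qed.

Lemma mexpD X s t : skew X -> 0 <= s -> mexp X (s + t) = mexp X s * mexp X t.
Proof.
move=> sX s0; rewrite -(mexp_shift_cst t sX s0) mulrA unitaryV ?mul1r//.
exact: mexp_unitary.
Qed.

Lemma mexpX X t n : skew X -> 0 <= t -> mexp X t ^+ n = mexp X (t *+ n).
Proof.
move=> sX t0; elim: n => [|n IH]; first by rewrite expr0 mulr0n mexp0.
by rewrite exprS IH mulrS mexpD.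
Qed.

Lemma mexp_opnorm X t : skew X -> opnorm (mexp X t) <= 1.
Proof. by move=> sX; exact/unitary_opnorm/mexp_unitary. Qed.

(** The curve exp(sX)^* X exp(sX) has zero derivative and stays equal to [X]; unitarity turns this
    into commutation, and adjoints carry it to negative times. *)
Lemma mexp_comm X t : skew X -> mexp X t * X = X * mexp X t.
Proof.
move=> sX.
have pos s : 0 <= s -> adjmx (mexp X s) * X * mexp X s = X.
  move=> s0; rewrite -[RHS]mulr1 -[X in _ = _ * X](mexp0 X) -[RHS]mul1r -(adjmx1 R d) -(mexp0 X).
  rewrite [RHS]mulrA.
  apply: (mderiv0_cst (f := fun s => adjmx (mexp X s) * X * mexp X s)) s0 => r.
  apply: mderiv_eq (mderivM (mderivM (mderiv_adjmx (mderiv_mexp X r))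
     (mderiv_cst X r)) (mderiv_mexp X r)) _.
  by rewrite adjmxM sX mulr0 addr0 !mulrN !mulNr !mulrA addrC subrr.
have posE s : 0 <= s -> mexp X s * X = X * mexp X s.
  by move=> s0; rewrite -{2}(pos s s0) !mulrA unitaryV ?mul1r//; exact: mexp_unitary.
have [/posE//|t0] := leP 0 t.
have Nt0 : 0 <= - t by rewrite oppr_ge0 ltW.
have e : mexp X t = adjmx (mexp X (- t)).
  by have := mexp_shift_cst t sX Nt0; rewrite addNr mexp0 mulr1.
rewrite e; apply: (can_inj (@adjmxK R d)).
by rewrite !adjmxM adjmxK sX mulNr mulrN posE.
Qed.

End MatrixExponential.

(** * The generator of a product of exponentials and its commutator expansion *)

Section TrotterError.
Local Open Scope complex_scope.
Set Implicit Arguments.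
Unset Strict Implicit.
Variables (R : realType) (d : nat).
Local Notation M := 'M[R[i]]_d.
Implicit Types (A B X Y : M) (L : seq M).

Lemma eq_opnormZr (x : R) A : 0 <= x -> opnorm (x%:C *: A) = x * opnorm A.
Proof.
rewrite le_eqVlt => /orP[/eqP <-|x0].
  by rewrite scale0r mul0r opnorm0.
apply/le_anti; rewrite (opnormZr _ (ltW x0))/= -ler_pdivlMl//.
have {1}-> : A = x^-1%:C *: (x%:C *: A).
  by rewrite scalerA -rmorphM/= mulVf ?gt_eqF// scale1r.
by rewrite opnormZr// invr_ge0 (ltW x0).
Qed.

Definition commmx A B : M := A * B - B * A.

Lemma opnorm_commmx A B : opnorm (commmx A B) <= 2 * opnorm A * opnorm B.
Proof.
apply: le_trans (opnormB _ _) _.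
rewrite -mulrA mulr_natl mulr2n; apply: (lerD (opnormM A B)).
by rewrite mulrC opnormM.
Qed.

(** A product formula flattened to one list: its coefficients are absorbed into the matrices [Y], so
    that all factors run for the same time. *)
Definition trot L (t : R) : M := \prod_(Y <- L) mexp Y t.

(* The generator of the product formula: [trot L]' = [tgen L * trot L]. *)
Fixpoint tgen L (t : R) : M :=
  if L is Y :: L' then Y + mexp Y t * tgen L' t * adjmx (mexp Y t) else 0.

(** Sums the norms of [Y_1, [Y_2, ... [Y_q, B]]] over all [q]-tuples from [L], repetitions
    included. *)
Fixpoint nest q L B : R :=
  if q is q'.+1 then \sum_(Y <- L) nest q' L (commmx Y B) else opnorm B.

Lemma nest_ge0 q L B : 0 <= nest q L B.
Proof.
elim: q B => [|q IH] B /=; first exact: opnorm_ge0.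
by apply: sumr_ge0.
Qed.

Lemma nest_cat q L L' B : nest q L B <= nest q (L ++ L') B.
Proof.
elim: q B => [|q IH] B //=; rewrite big_cat/=.
apply: (@le_trans _ _ (\sum_(Y <- L) nest q (L ++ L') (commmx Y B))).
  by apply: ler_sum => Y _; exact: IH.
by rewrite lerDl sumr_ge0// => Y _; exact: nest_ge0.
Qed.

(** The left side collects the tuples in which all copies of [X] act before any member of [L]; these
    are the commutators produced by expanding the innermost conjugation first. *)
Lemma nest_rcons q L X B :
  \sum_(i < q.+1) nest (q - i) L (iter i (commmx X) B) <= nest q (rcons L X) B.
Proof.
elim: q B => [|q IH] B; first by rewrite big_ord1.
rewrite big_ord_recl subn0 [leRHS]/= big_rcons/=.
apply: lerD.
  by apply: ler_sum => Y _; rewrite -cats1 nest_cat.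
apply: le_trans (IH (commmx X B)).
by apply: ler_sum => i _; rewrite add0n -iterS iterSr /bump add1n subSS.
Qed.

Section Approximation.
Implicit Types (f g : R -> M) (K : R).

(** The polynomial of degree below [q] stays behind the existential, since only the constant [K] of
    the remainder is tracked. *)
Definition polyapx q f K := exists G : nat -> M, forall t, 0 <= t ->
  opnorm (f t - \sum_(i < q) (t ^+ i)%:C *: G i) <= K * t ^+ q.

Lemma polyapx_ext q f g K : f =1 g -> polyapx q f K -> polyapx q g K.
Proof. by move=> /funext ->. Qed.

Lemma polyapx_le q f K K' : K <= K' -> polyapx q f K -> polyapx q f K'.
Proof.
move=> KK' [G GK]; exists G => t t0; apply: le_trans (GK t t0) _.
by rewrite ler_wpM2r ?exprn_ge0.
Qed.

Lemma polyapxD q f g K K' : polyapx q f K -> polyapx q g K' ->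
  polyapx q (fun t => f t + g t) (K + K').
Proof.
move=> [G GK] [G' GK']; exists (fun i => G i + G' i) => t t0.
under eq_bigr do rewrite scalerDr.
rewrite big_split/= opprD addrACA mulrDl.
by apply: le_trans (opnormD _ _) _; exact: lerD (GK t t0) (GK' t t0).
Qed.

Lemma polyapx_small q f K : (forall t, 0 <= t -> opnorm (f t) <= K * t ^+ q) ->
  polyapx q f K.
Proof.
move=> fK; exists (fun=> 0) => t t0.
by rewrite big1 ?subr0 ?fK// => i _; rewrite scaler0.
Qed.

Lemma polyapx_sum q n (f : 'I_n -> R -> M) (K : 'I_n -> R) :
  (forall i, polyapx q (f i) (K i)) ->
  polyapx q (fun t => \sum_i f i t) (\sum_i K i).
Proof.
elim: n f K => [|n IH] f K fK.
  rewrite big_ord0; apply: polyapx_small => t _.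
  by rewrite big_ord0 opnorm0 mul0r.
rewrite big_ord_recr/=.
apply: (polyapx_ext (f := fun t => \sum_(k < n) f (widen_ord (leqnSn n) k) t
   + f ord_max t)); first by move=> t; rewrite big_ord_recr.
by apply: polyapxD (fK _); exact: IH.
Qed.

Lemma polyapxZ q f K (c : R) : 0 <= c <= 1 -> 0 <= K -> polyapx q f K ->
  polyapx q (fun t => c%:C *: f t) K.
Proof.
move=> /andP[c0 c1] K0 [G GK]; exists (fun i => c%:C *: G i) => t t0.
under eq_bigr do rewrite scalerA mulrC -scalerA.
rewrite -scaler_sumr -scalerBr eq_opnormZr//.
apply: le_trans (ler_wpM2l c0 (GK t t0)) _.
by rewrite ler_piMl// mulr_ge0 ?exprn_ge0.
Qed.

Lemma polyapx_shift q n f K : polyapx q f K ->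
  polyapx (n + q) (fun t => (t ^+ n)%:C *: f t) K.
Proof.
move=> [G GK]; exists (fun i => if (i < n)%N then 0 else G (i - n)%N) => t t0.
rewrite big_split_ord/= big1 ?add0r => [|i _]; last by rewrite ltn_ord scaler0.
under eq_bigr do rewrite ltnNge leq_addr/= addKn exprD rmorphM -scalerA.
rewrite -scaler_sumr -scalerBr eq_opnormZr ?exprn_ge0//.
by rewrite exprD mulrCA ler_wpM2l ?exprn_ge0// GK.
Qed.

End Approximation.

Definition skews L := forall Y, Y \in L -> skew Y.

Lemma skews_cons Y L : skews (Y :: L) -> skew Y /\ skews L.
Proof.
move=> sL; split; first by apply: sL; rewrite mem_head.
by move=> Z ZL; apply: sL; rewrite in_cons ZL orbT.
Qed.

Lemma trot_cons Y L t : trot (Y :: L) t = mexp Y t * trot L t.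
Proof. by rewrite /trot big_cons. Qed.

Lemma trot_cat L L' t : trot (L ++ L') t = trot L t * trot L' t.
Proof. by rewrite /trot big_cat. Qed.

Lemma trot_rcons L Y t : trot (rcons L Y) t = trot L t * mexp Y t.
Proof. by rewrite -cats1 trot_cat /trot big_seq1. Qed.

Lemma trot_unitary L t : skews L -> unitary (trot L t).
Proof.
elim: L => [_|Y L IH /skews_cons[sY sL]].
  by rewrite /trot big_nil; exact: unitary1.
by rewrite trot_cons; apply: unitaryM (IH sL); exact: mexp_unitary.
Qed.

Lemma trot_opnorm L t : skews L -> opnorm (trot L t) <= 1.
Proof. by move=> sL; exact/unitary_opnorm/trot_unitary. Qed.

Lemma adj_trot_opnorm L t : skews L -> opnorm (adjmx (trot L t)) <= 1.
Proof. by move=> sL; exact/unitary_opnorm/unitary_adj/trot_unitary. Qed.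

Lemma adj_mexp_opnorm X t : skew X -> opnorm (adjmx (mexp X t)) <= 1.
Proof. by move=> sX; exact/unitary_opnorm/unitary_adj/mexp_unitary. Qed.

Lemma trot0 L : trot L 0 = 1.
Proof. by rewrite /trot big1// => Y _; rewrite mexp0. Qed.

(** Inserting [adjmx (mexp Y t) * mexp Y t = 1] before the tail turns the Leibniz rule into the
    recursion of [tgen]. *)
Lemma mderiv_trot L t : skews L -> mderiv (trot L) t (tgen L t * trot L t).
Proof.
elim: L => [_|Y L IH /skews_cons[sY sL]].
  rewrite mul0r; apply: mderiv_ext (mderiv_cst 1 t) => s.
  by rewrite /trot big_nil.
apply: (mderiv_ext (f := fun t => mexp Y t * trot L t)).
  by move=> s; rewrite trot_cons.
apply: mderiv_eq (mderivM (mderiv_mexp Y t) (IH sL)) _.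
have eK : adjmx (mexp Y t) * (mexp Y t * trot L t) = trot L t.
  by rewrite mulrA (mexp_unitary t sY) mul1r.
rewrite /= trot_cons mulrDl -[Y * _ * _]mulrA; congr (_ + _).
by rewrite -[RHS]mulrA eK -mulrA.
Qed.

Lemma tgen_opnorm L t : skews L -> opnorm (tgen L t) <= \sum_(Y <- L) opnorm Y.
Proof.
elim: L => [_|Y L IH /skews_cons[sY sL]] /=; first by rewrite opnorm0 big_nil.
rewrite big_cons; apply: le_trans (opnormD _ _) _; rewrite lerD2l.
apply: le_trans (opnormM3 _ _ _) (IH sL); first exact: mexp_opnorm.
exact: adj_mexp_opnorm.
Qed.

Lemma mderiv_conj_mexp X B t : skew X ->
  mderiv (fun t => mexp X t * B * adjmx (mexp X t)) t
    (mexp X t * commmx X B * adjmx (mexp X t)).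
Proof.
move=> sX.
apply: mderiv_eq (mderivM (mderivM (mderiv_mexp X t) (mderiv_cst B t))
  (mderiv_adjmx (mderiv_mexp X t))) _.
have eX := mexp_comm t sX.
have eX' : adjmx (mexp X t) * X = X * adjmx (mexp X t).
  by have /(congr1 (@adjmx R d)) := eX; rewrite !adjmxM sX mulNr mulrN => /oppr_inj.
rewrite mulr0 addr0 adjmxM sX -eX mulrN mulrN eX' /commmx mulrBr mulrBl.
by rewrite !mulrA.
Qed.

(** The remainder of order [q.+1] for [B] vanishes at 0, and its derivative is the remainder of
    order [q] for [commmx X B]; the mean value inequality raises the power of [t] by one. *)
Lemma conj_mexp_taylor X B q t : skew X -> 0 <= t ->
  opnorm (mexp X t * B * adjmx (mexp X t)
     - \sum_(i < q) (t ^+ i / i`!%:R)%:C *: iter i (commmx X) B)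
    <= opnorm (iter q (commmx X) B) * t ^+ q.
Proof.
move=> sX; elim: q B t => [|q IH] B t t0.
  rewrite big_ord0 subr0 mulr1 /=.
  by apply: opnormM3; [exact: mexp_opnorm|exact: adj_mexp_opnorm].
pose f t := mexp X t * B * adjmx (mexp X t)
     - \sum_(i < q.+1) (t ^+ i / i`!%:R)%:C *: iter i (commmx X) B.
have f0 : f 0 = 0.
  rewrite /f mexp0 adjmx1 mul1r mulr1 big_ord_recl big1 => [|i _].
    by rewrite expr0 fact0 invr1 mulr1 scale1r addr0 subrr.
  by rewrite /= expr0n /= mul0r scale0r.
rewrite -/(f t) -[f t]subr0 -f0 iterSr.
apply: (mderiv_leX t0 (f' := fun t => mexp X t * commmx X B * adjmx (mexp X t)
     - \sum_(i < q) (t ^+ i / i`!%:R)%:C *: iter i (commmx X) (commmx X B))).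
  move=> s; apply: mderivB; first exact: mderiv_conj_mexp.
  apply: (@mderiv_eq _ _ _ _ (\sum_(i < q.+1)
     (i%:R * s ^+ i.-1 / i`!%:R)%:C *: iter i (commmx X) B)).
    apply: mderiv_sum => i; apply: mderivZ.
    apply: is_derive_eq (is_derive1M (is_derive1Xn i s)
       (is_derive_cst (i`!%:R^-1 : R) s (1 : R))) _.
    by rewrite mulr0 addr0.
  rewrite big_ord_recl /= !mul0r scale0r add0r; apply: eq_bigr => i _.
  rewrite -iterS iterSr /bump/= add1n/= factS natrM invfM.
  by rewrite mulrAC mulrA divff ?pnatr_eq0// mul1r mulrC.
by move=> s /andP[s0 _]; exact: IH.
Qed.

(* The innermost conjugation is Taylor expanded to order [q]; its remainder
   stays bounded under the outer unitary conjugations, which are in turn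
   expanded to the complementary orders on each Taylor term. *)
Lemma conj_trot_polyapx L q B : skews L ->
  polyapx q (fun t => trot L t * B * adjmx (trot L t)) (nest q L B).
Proof.
elim/last_ind: L q B => [|L X IH] q B sL.
  apply: (@polyapx_ext _ (fun=> B)) => [t|].
    by rewrite /trot big_nil adjmx1 mul1r mulr1.
  (* [nest q [::] B] is the norm of [B] for [q = 0] and 0 otherwise, so in the second case [B]
     itself has to be the constant coefficient. *)
  case: q => [|q].
    by apply: polyapx_small => t _; rewrite mulr1.
  exists (fun i => if i == 0%N then B else 0) => t t0.
  rewrite big_ord_recl big1 ?addr0 => [|i _]; last by rewrite scaler0.
  by rewrite /= expr0 scale1r subrr opnorm0 big_nil mul0r.
have sX : skew X by apply: sL; rewrite mem_rcons mem_head.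
have {}sL : skews L.
  by move=> Y YL; apply: sL; rewrite mem_rcons in_cons YL orbT.
pose C i := iter i (commmx X) B.
pose U B t := trot L t * B * adjmx (trot L t).
pose r t := mexp X t * B * adjmx (mexp X t)
     - \sum_(i < q) (t ^+ i / i`!%:R)%:C *: C i.
apply: polyapx_le (nest_rcons q L X B) _.
rewrite big_ord_recr subnn.
apply: (@polyapx_ext _ (fun t => \sum_(i < q) (i`!%:R^-1 : R)%:C *:
     ((t ^+ i)%:C *: U (C i) t) + U (r t) t)) => [t|].
  have -> : \sum_(i < q) (i`!%:R^-1 : R)%:C *: ((t ^+ i)%:C *: U (C i) t) =
      U (\sum_(i < q) (t ^+ i / i`!%:R)%:C *: C i) t.
    rewrite /U -!mulmxE mulmx_sumr mulmx_suml; apply: eq_bigr => i _.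
    by rewrite -scalemxAr -scalemxAl scalerA -rmorphM/= mulrC.
  rewrite /U /r mulrBr mulrBl [LHS]addrC subrK.
  by rewrite trot_rcons adjmxM !mulrA.
apply: polyapxD; last first.
  apply: polyapx_small => t t0.
  apply: le_trans (conj_mexp_taylor B q sX t0).
  by apply: opnormM3; [exact: trot_opnorm|exact: adj_trot_opnorm].
apply: polyapx_sum => i; apply: polyapxZ.
- by rewrite invr_ge0 ler0n invf_le1 ?ltr0n ?ler1n fact_gt0.
- exact: nest_ge0.
- have {1}-> : q = (i + (q - i))%N by rewrite subnKC// ltnW.
  exact/polyapx_shift/IH.
Qed.

(** [L0] holds the factors already passed: unfolding [tgen] leaves each [Y] conjugated by the
    product of the factors before it, and these conjugations are expanded one by one. *)
Lemma tgen_polyapx q L L0 : skews (L0 ++ L) ->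
  polyapx q (fun t => trot L0 t * tgen L t * adjmx (trot L0 t))
    (\sum_(Y <- L) nest q (L0 ++ L) Y).
Proof.
elim: L L0 => [|Y L IH] L0 sL.
  rewrite big_nil; apply: polyapx_small => t t0.
  by rewrite /= mulr0 mul0r opnorm0 mul0r.
rewrite big_cons.
apply: (@polyapx_ext _ (fun t => trot L0 t * Y * adjmx (trot L0 t)
    + trot (rcons L0 Y) t * tgen L t * adjmx (trot (rcons L0 Y) t))) => [t|].
  by rewrite /= trot_rcons adjmxM mulrDr mulrDl !mulrA.
apply: polyapxD.
  apply: polyapx_le (nest_cat q L0 (Y :: L) Y) _; apply: conj_trot_polyapx.
  by move=> Z ZL; apply: sL; rewrite mem_cat ZL.
by rewrite -cat_rcons; apply: IH; rewrite cat_rcons.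
Qed.

End TrotterError.

(** * Order conditions and the commutator bound on the error *)

Section OrderConditions.
Local Open Scope complex_scope.
Set Implicit Arguments.
Unset Strict Implicit.
Variables (R : realType) (d : nat).
Local Notation M := 'M[R[i]]_d.
Implicit Types (A B X Y : M) (L : seq M).

Lemma le0_of_linear_bound (x K e : R) : 0 < e ->
  (forall t, 0 < t < e -> x <= K * t) -> x <= 0.
Proof.
move=> e0 xK; rewrite leNgt; apply/negP => x0.
have K0 : 0 < `|K| + 1 by rewrite ltr_wpDl.
pose t := Num.min (e / 2) (x / (2 * (`|K| + 1))).
have t0 : 0 < t by rewrite lt_min !divr_gt0// mulr_gt0.
have te : t < e by rewrite gt_min ltr_pdivrMr// mulr_natr mulr2n ltrDl e0.
have := xK t; rewrite t0 te => /(_ isT); apply/negP; rewrite -ltNge.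
have tx : t * (2 * (`|K| + 1)) <= x.
  by rewrite -ler_pdivlMr ?mulr_gt0// ge_min lexx orbT.
have KK : K <= `|K| by exact: ler_norm.
nra.
Qed.

(** The cost of replacing both outer factors by 1, from E^* G S - G = E^*
    [G (S - 1) - (E - 1) G]. *)
Lemma unitary_conj_sub (E S G : M) : unitary E -> opnorm S <= 1 ->
  opnorm (adjmx E * G * S - G) <= opnorm G * (opnorm (S - 1) + opnorm (E - 1)).
Proof.
move=> EU S1.
have -> : adjmx E * G * S - G = adjmx E * (G * (S - 1) - (E - 1) * G).
  have -> : G * (S - 1) - (E - 1) * G = G * S - E * G.
    by rewrite mulrBr mulrBl mulr1 mul1r opprB addrA subrK.
  by rewrite mulrBr !mulrA EU mul1r.
have E1 := unitary_opnorm (unitary_adj EU).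
apply: le_trans (opnormM _ _) _.
apply: le_trans (ler_piMl (opnorm_ge0 _) E1) _.
apply: le_trans (opnormB _ _) _; rewrite [leRHS]mulrDr; apply: lerD.
  exact: opnormM.
by rewrite mulrC opnormM.
Qed.

Lemma trot_sub1 L t : skews L -> 0 <= t ->
  opnorm (trot L t - 1) <= (\sum_(Y <- L) opnorm Y) * t.
Proof.
move=> sL t0; have := mderiv_leX (n := 0) t0 (fun s => mderiv_trot s sL).
rewrite trot0 expr1; apply => s _; rewrite mulr1.
apply: le_trans (opnormM _ _) _.
apply: le_trans (ler_piMr (opnorm_ge0 _) (trot_opnorm s sL)) _.
exact: tgen_opnorm.
Qed.

Lemma mexp_sub1 X t : skew X -> 0 <= t -> opnorm (mexp X t - 1) <= opnorm X * t.
Proof.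
move=> sX t0; have := @trot_sub1 [:: X] t _ t0.
rewrite /trot !big_seq1; apply => Y; rewrite mem_seq1 => /eqP ->//.
Qed.

(** The interaction picture: differentiating the adjoint of the exact evolution contributes the
    [- X] that is added to the generator of the formula. *)
Lemma mderiv_interaction L X t : skews L -> skew X ->
  mderiv (fun t => adjmx (mexp X t) * trot L t) t
    (adjmx (mexp X t) * (tgen L t - X) * trot L t).
Proof.
move=> sL sX; apply: mderiv_eq (mderivM (mderiv_adjmx (mderiv_mexp X t))
  (mderiv_trot t sL)) _.
rewrite adjmxM sX mulrN mulNr addrC mulrBr mulrBl.
by rewrite mulrA.
Qed.

(* If [G m] is the first nonzero Taylor coefficient of [tgen L - X], then the
   derivative of [exp(tX)^* trot L t] is [t^m G m + O(t^(m+1))], which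
   contradicts the order condition as long as [m < p]. *)
Lemma order_condition L X p (G : nat -> M) (K C delta : R) :
  skews L -> skew X -> 0 < delta ->
  (forall t, 0 <= t -> t < delta ->
     opnorm (trot L t - mexp X t) <= C * t ^+ p.+1) ->
  (forall t, 0 <= t ->
     opnorm (tgen L t - X - \sum_(i < p) (t ^+ i)%:C *: G i) <= K * t ^+ p) ->
  forall m, (m < p)%N -> G m = 0.
Proof.
move=> sL sX delta0 ord GK.
elim/ltn_ind => m IH mp; apply: opnorm_eq0.
have K0 : 0 <= K.
  by have := GK 1 ler01; rewrite expr1n mulr1; exact/le_trans/opnorm_ge0.
(* [K1] bounds the Taylor terms of [tgen L - X] beyond degree [m], [K2] the rate at which the two
   evolutions leave 1, and [K3] serves for the derivative of [f] below. *)
pose K1 := K + \sum_(i < p) opnorm (G i).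
pose K2 := \sum_(Y <- L) opnorm Y + opnorm X.
pose K3 := K1 + opnorm (G m) * K2.
have leX1 (t : R) j k : 0 <= t <= 1 -> (k <= j)%N -> t ^+ j <= t ^+ k.
  by move=> /andP[t0 t1] kj; apply: ler_wiXn2l.
have lead t : 0 <= t <= 1 ->
    opnorm (tgen L t - X - (t ^+ m)%:C *: G m) <= K1 * t ^+ m.+1.
  move=> t01; have /andP[t0 t1] := t01.
  have -> : tgen L t - X - (t ^+ m)%:C *: G m =
      (tgen L t - X - \sum_(i < p) (t ^+ i)%:C *: G i)
      + \sum_(i < p | i != m :> nat) (t ^+ i)%:C *: G i.
    rewrite [\sum_(i < p) _ *: _](bigD1 (Ordinal mp))//=.
    have -> : \sum_(i < p | i != Ordinal mp) (t ^+ i)%:C *: G i =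
        \sum_(i < p | i != m :> nat) (t ^+ i)%:C *: G i by apply: eq_bigl.
    by rewrite opprD addrA subrK.
  apply: le_trans (opnormD _ _) _; rewrite mulrDl; apply: lerD.
    by apply: le_trans (GK t t0) _; rewrite ler_wpM2l// leX1.
  apply: le_trans (opnorm_sum _ _ _) _; rewrite mulr_suml big_mkcond/=.
  apply: ler_sum => i _; case: ifPn => [im|_]; last first.
    by rewrite mulr_ge0 ?opnorm_ge0 ?exprn_ge0.
  have [lim|mi] := ltnP i m.
    by rewrite IH// scaler0 opnorm0 mul0r.
  rewrite eq_opnormZr ?exprn_ge0// mulrC ler_wpM2l ?opnorm_ge0// leX1//.
  by rewrite ltn_neqAle eq_sym im.
pose D t := adjmx (mexp X t) * trot L t.
(* The subtracted term is the integral of t^m G_m, so [f'] is O(t^(m+1)) and [f] stays within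
   O(t^(m+2)) of its initial value. *)
pose f t := D t - (t ^+ m.+1 / m.+1%:R)%:C *: G m.
pose f' t := adjmx (mexp X t) * (tgen L t - X) * trot L t - (t ^+ m)%:C *: G m.
have Df t : mderiv f t (f' t).
  apply: mderivB; first exact: mderiv_interaction.
  apply: mderivZ.
  apply: is_derive_eq (is_derive1M (is_derive1Xn m.+1 t)
     (is_derive_cst (m.+1%:R^-1 : R) t (1 : R))) _.
  by rewrite mulr0 addr0/= mulrAC divff ?pnatr_eq0// mul1r.
have f'K t : 0 <= t <= 1 -> opnorm (f' t) <= K3 * t ^+ m.+1.
  move=> t01; have /andP[t0 t1] := t01.
  have EU := mexp_unitary t sX.
  have -> : f' t = adjmx (mexp X t) * (tgen L t - X - (t ^+ m)%:C *: G m) * trot L t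
      + (t ^+ m)%:C *: (adjmx (mexp X t) * G m * trot L t - G m).
    rewrite /f' [in RHS]mulrBr [in RHS]mulrBl scalerBr -!mulmxE.
    by rewrite -scalemxAr -scalemxAl addrA subrK.
  apply: le_trans (opnormD _ _) _; rewrite mulrDl; apply: lerD.
    apply: le_trans (lead t t01); apply: opnormM3.
      exact: adj_mexp_opnorm.
    exact: trot_opnorm.
  rewrite eq_opnormZr ?exprn_ge0// exprSr mulrCA ler_wpM2l ?exprn_ge0//.
  apply: le_trans (unitary_conj_sub _ EU (trot_opnorm t sL)) _.
  rewrite -mulrA ler_wpM2l ?opnorm_ge0// /K2 mulrDl; apply: lerD.
    exact: trot_sub1.
  exact: mexp_sub1.
apply: (@le0_of_linear_bound _ ((K3 + `|C|) * m.+1%:R) (Num.min delta 1)).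
  by rewrite lt_min delta0 ltr01.
move=> t /andP[t0]; rewrite lt_min => /andP[td t1].
have t01 : 0 <= t <= 1 by rewrite (ltW t0) (ltW t1).
have fK : opnorm (f t - f 0) <= K3 * t ^+ m.+2.
  apply: (mderiv_leX (ltW t0) Df) => s /andP[s0 st].
  by apply: f'K; rewrite s0 (le_trans st)// ltW.
(* The order hypothesis gives t^(p+1), which is at most t^(m+2) because [m < p] and [t < 1]. *)
have DK : opnorm (D t - 1) <= `|C| * t ^+ m.+2.
  have EU := mexp_unitary t sX.
  have -> : D t - 1 = adjmx (mexp X t) * (trot L t - mexp X t).
    by rewrite mulrBr EU.
  apply: le_trans (opnormM _ _) _.
  apply: le_trans (ler_piMl (opnorm_ge0 _) (adj_mexp_opnorm t sX)) _.
  apply: le_trans (ord t (ltW t0) td) _.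
  have CC : C <= `|C| by exact: ler_norm.
  apply: (@le_trans _ _ (`|C| * t ^+ p.+1)).
    by rewrite ler_wpM2r// exprn_ge0// ltW.
  by rewrite ler_wpM2l// leX1.
have : opnorm ((t ^+ m.+1 / m.+1%:R)%:C *: G m) <= (K3 + `|C|) * t ^+ m.+2.
  have -> : (t ^+ m.+1 / m.+1%:R)%:C *: G m = (D t - 1) - (f t - f 0).
    have -> : f 0 = 1.
      by rewrite /f /D mexp0 trot0 adjmx1 mulr1 expr0n/= mul0r scale0r subr0.
    by rewrite /f opprB addrA subrK opprB addrCA subrr addr0.
  apply: le_trans (opnormB _ _) _.
  by rewrite mulrDl addrC; exact: lerD.
have tm0 : 0 < t ^+ m.+1 by rewrite exprn_gt0.
rewrite eq_opnormZr; last by rewrite divr_ge0 ?ltW.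
rewrite mulrAC ler_pdivrMr ?ltr0n//.
have -> : (K3 + `|C|) * t ^+ m.+2 * m.+1%:R =
    t ^+ m.+1 * ((K3 + `|C|) * m.+1%:R * t) by rewrite (exprSr t m.+1); ring.
by rewrite ler_pM2l.
Qed.

(** The order hypothesis serves to remove the polynomial part of [tgen L - X]; the resulting bound
    holds for all [t >= 0] and contains neither [C] nor [delta]. *)
Theorem trotter_error L X p (C delta : R) : (0 < p)%N ->
  skews L -> skew X -> 0 < delta ->
  (forall t, 0 <= t -> t < delta ->
     opnorm (trot L t - mexp X t) <= C * t ^+ p.+1) ->
  forall t, 0 <= t ->
  opnorm (trot L t - mexp X t) <= (\sum_(Y <- L) nest p L Y) * t ^+ p.+1.
Proof.
move=> p0 sL sX delta0 ord.
set K := \sum_(Y <- L) nest p L Y.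
have [G0 G0K] := @tgen_polyapx R d p L [::] sL.
(* [X] is constant in [t], so it is taken out of the coefficient of degree 0, which exists because
   [0 < p]. *)
pose G i := if i == 0%N then G0 0%N - X else G0 i.
have sumG t q : (0 < q)%N ->
    \sum_(i < q) (t ^+ i)%:C *: G i = \sum_(i < q) (t ^+ i)%:C *: G0 i - X.
  case: q => // q _; rewrite !big_ord_recl /G/= expr0 !scale1r.
  by rewrite [LHS]addrAC.
have GK t : 0 <= t ->
    opnorm (tgen L t - X - \sum_(i < p) (t ^+ i)%:C *: G i) <= K * t ^+ p.
  move=> t0; rewrite sumG// opprB addrA subrK.
  by have := G0K t t0; rewrite /trot big_nil adjmx1 mul1r mulr1.
have G00 := order_condition sL sX delta0 ord GK.
have FK t : 0 <= t -> opnorm (tgen L t - X) <= K * t ^+ p.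
  move=> t0; have := GK t t0; rewrite big1 ?subr0// => i _.
  by rewrite G00 ?scaler0.
move=> t t0; have EU := mexp_unitary t sX.
have -> : trot L t - mexp X t =
    mexp X t * (adjmx (mexp X t) * trot L t - adjmx (mexp X 0) * trot L 0).
  by rewrite mexp0 trot0 adjmx1 mulr1 mulrBr mulr1 mulrA unitaryV// mul1r.
apply: le_trans (opnormM _ _) _.
apply: le_trans (ler_piMl (opnorm_ge0 _) (mexp_opnorm t sX)) _.
apply: (mderiv_leX t0 (fun s => mderiv_interaction s sL sX)) => s /andP[s0 _].
apply: le_trans (FK s s0); apply: opnormM3; last exact: trot_opnorm.
exact: adj_mexp_opnorm.
Qed.

End OrderConditions.

(** * Nested commutators of local terms *)

Section Locality.
Local Open Scope complex_scope.
Set Implicit Arguments.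
Unset Strict Implicit.
Variables (R : realType) (d : nat).
Local Notation M := 'M[R[i]]_d.
Implicit Types (B X Y : M) (L : seq M).

Lemma commmx_eq0 X B : X * B = B * X -> commmx X B = 0.
Proof. by rewrite /commmx => ->; rewrite subrr. Qed.

Lemma nest0 q L : nest q L 0 = 0.
Proof.
elim: q => [|q IH] /=; first exact: opnorm0.
by rewrite big1// => Y _; rewrite commmx_eq0 ?IH// mulr0 mul0r.
Qed.

(** The crude bound for the inner formulas: each commutator with [Y] costs at most
    [2 * opnorm Y]. *)
Lemma nest_le_norm q L B :
  nest q L B <= (2 * \sum_(Y <- L) opnorm Y) ^+ q * opnorm B.
Proof.
have S0 : 0 <= \sum_(Y <- L) opnorm Y by apply: sumr_ge0 => Y _; exact: opnorm_ge0.
elim: q B => [|q IH] B /=; first by rewrite expr0 mul1r.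
apply: (@le_trans _ _ (\sum_(Y <- L)
    (2 * \sum_(Y <- L) opnorm Y) ^+ q * (2 * opnorm Y * opnorm B))).
  apply: ler_sum => Y _; apply: le_trans (IH _) _.
  by rewrite ler_wpM2l ?opnorm_commmx// exprn_ge0// mulr_ge0.
rewrite -mulr_sumr -mulr_suml -mulr_sumr.
by rewrite exprSr -[leRHS]mulrA.
Qed.

Variables (n k NL N : nat) (J : 'I_n -> k.-tuple 'I_NL) (H : 'I_n -> M).
Variables (T : Type) (s : seq T) (h : T -> 'I_n) (z : T -> R[i]).
Variables (alpha mu : R).
Hypothesis alpha0 : 0 <= alpha.
Hypothesis mu0 : 0 <= mu.
Hypothesis H_comm : forall g g', ~~ has (mem (J g')) (J g) -> H g * H g' = H g' * H g.
Hypothesis H_mu : forall l j, \sum_(g < n | tnth (J g) l == j) opnorm (H g) <= mu.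
Hypothesis s_sum : forall w : 'I_n -> R, \sum_(x <- s) w (h x) = N%:R * \sum_g w g.
Hypothesis z_le : forall x, cabs (z x) <= alpha.

(** The factors of a product formula: each is a bounded multiple of some [H g], and by [s_sum] every
    [g] occurs [N] times. *)
Let L := [seq z x *: H (h x) | x <- s].

(* Weaker than acting on the sites [Z] only, but all that the commutator bound
   needs of the tensor structure. *)
Definition supported (Z : seq 'I_NL) B :=
  forall g, ~~ has (mem Z) (J g) -> H g * B = B * H g.

Lemma supported_term g (c : R[i]) : supported (J g) (c *: H g).
Proof.
by move=> g' gg'; rewrite -!mulmxE -scalemxAr -scalemxAl mulmxE H_comm.
Qed.

Lemma supported_commmx Z Z' X B : supported Z X -> supported Z' B ->
  supported (Z ++ Z') (commmx X B).
Proof.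
move=> sX sB g gZ.
have gX : H g * X = X * H g.
  apply: sX; apply: contra gZ => /hasP[j jJ jZ]; apply/hasP; exists j => //=.
  by rewrite mem_cat; apply/orP; left.
have gB : H g * B = B * H g.
  apply: sB; apply: contra gZ => /hasP[j jJ jZ]; apply/hasP; exists j => //=.
  by rewrite mem_cat; apply/orP; right.
rewrite /commmx mulrBr mulrBl !mulrA gX gB.
by rewrite -(mulrA X) gB -(mulrA B) gX !mulrA.
Qed.

(** A union bound: a term that meets [Z] has a site of [Z] at some position [l], so the sum over
    sites and positions counts it at least once. *)
Lemma sum_overlap_le (Z : seq 'I_NL) :
  \sum_(g < n | has (mem Z) (J g)) opnorm (H g) <= (size Z)%:R * k%:R * mu.
Proof.
apply: (@le_trans _ _ (\sum_(j <- Z) \sum_(l < k)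
    \sum_(g < n | tnth (J g) l == j) opnorm (H g))); last first.
  apply: (@le_trans _ _ (\sum_(j <- Z) \sum_(l < k) mu)).
    by apply: ler_sum => j _; apply: ler_sum => l _; exact: H_mu.
  rewrite big_const_seq count_predT iter_addr_0 sumr_const card_ord.
  by rewrite -mulrA !mulr_natl.
have -> : \sum_(j <- Z) \sum_(l < k) \sum_(g < n | tnth (J g) l == j) opnorm (H g) =
    \sum_g \sum_(j <- Z) \sum_(l < k) (if tnth (J g) l == j then opnorm (H g) else 0).
  rewrite [RHS]exchange_big; apply: eq_bigr => j _.
  by rewrite [RHS]exchange_big; apply: eq_bigr => l _; rewrite big_mkcond.
have if0 g l j : 0 <= if tnth (J g) l == j then opnorm (H g) else 0.
  by case: ifP => // _; exact: opnorm_ge0.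
rewrite big_mkcond/=.
apply: ler_sum => g _; case: ifPn => [/hasP[j /tnthP[l ->] jZ]|_]; last first.
  by apply: sumr_ge0 => j _; exact: sumr_ge0.
rewrite (big_rem _ jZ)/= (bigD1 l)//= eqxx -addrA lerDl addr_ge0//.
  exact: sumr_ge0.
by apply: sumr_ge0 => ? _; exact: sumr_ge0.
Qed.

(** The price of one commutator per block of [k] sites: 2 from the commutator, [alpha] from the
    coefficients, [N] from the multiplicity, and [k ^+ 2 * mu] from [k] sites with [k] positions
    each. *)
Let c0 := 2 * alpha * N%:R * k%:R ^+ 2 * mu.

Lemma c0_ge0 : 0 <= c0.
Proof. by rewrite /c0 !mulr_ge0. Qed.

(** A support of at most [m] blocks of [k] sites grows by at most one block with each commutator, so
    all [q] of them are charged for [m + q] blocks. *)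
Lemma nest_local q m (Z : seq 'I_NL) B : supported Z B -> (size Z <= m * k)%N ->
  nest q L B <= (c0 * (m + q)%:R) ^+ q * opnorm B.
Proof.
elim: q m Z B => [|q IH] m Z B sB Zm; first by rewrite expr0 mul1r.
have cq0 : 0 <= (c0 * (m + q.+1)%:R) ^+ q by rewrite exprn_ge0// mulr_ge0// c0_ge0.
rewrite /= big_map.
apply: (@le_trans _ _ (\sum_(x <- s) (c0 * (m + q.+1)%:R) ^+ q
    * (2 * alpha * opnorm B * (if has (mem Z) (J (h x)) then opnorm (H (h x)) else 0)))).
  (* A term that misses [Z] commutes with [B] and contributes nothing. *)
  apply: ler_sum => x _; case: ifPn => [_|xZ]; last first.
    rewrite commmx_eq0 ?nest0 ?mulr0//.
    by rewrite -!mulmxE -scalemxAr -scalemxAl mulmxE sB.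
  apply: (@le_trans _ _ ((c0 * (m + q.+1)%:R) ^+ q * opnorm (commmx (z x *: H (h x)) B))).
    (* One more block and one commutator fewer leave the factor unchanged. *)
    rewrite addnS -addSn.
    apply: IH (supported_commmx (supported_term (g := h x) _) sB) _.
    by rewrite size_cat size_tuple mulSn leq_add2l.
  apply: (ler_wpM2l cq0); apply: le_trans (opnorm_commmx _ _) _.
  rewrite [leRHS]mulrAC; apply: (ler_wpM2r (opnorm_ge0 _)).
  rewrite -[leRHS]mulrA; apply: (ler_wpM2l (ler0n R 2)).
  apply: le_trans (opnormZ _ _) _.
  exact: (ler_wpM2r (opnorm_ge0 _)).
rewrite -mulr_sumr exprSr -[leRHS]mulrA ler_wpM2l//.
rewrite -mulr_sumr (s_sum (fun g => if has (mem Z) (J g) then opnorm (H g) else 0)).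
rewrite -big_mkcond/=.
have le1 : \sum_(g < n | has (mem Z) (J g)) opnorm (H g) <= m%:R * k%:R ^+ 2 * mu.
  apply: le_trans (sum_overlap_le Z) _; rewrite ler_wpM2r//.
  by rewrite expr2 mulrA ler_wpM2r// -natrM ler_nat.
apply: (@le_trans _ _ (2 * alpha * opnorm B * (N%:R * (m%:R * k%:R ^+ 2 * mu)))).
  by rewrite ler_wpM2l ?mulr_ge0 ?opnorm_ge0// ler_wpM2l.
have -> : 2 * alpha * opnorm B * (N%:R * (m%:R * k%:R ^+ 2 * mu)) =
    c0 * m%:R * opnorm B by rewrite /c0; ring.
rewrite ler_wpM2r ?opnorm_ge0// ler_wpM2l ?c0_ge0// ler_nat.
exact: leq_addr.
Qed.

Lemma sum_nest_local p : \sum_(Y <- L) nest p L Y <=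
  (c0 * p.+1%:R) ^+ p * (alpha * N%:R * \sum_g opnorm (H g)).
Proof.
have cp0 : 0 <= (c0 * p.+1%:R) ^+ p by rewrite exprn_ge0// mulr_ge0// c0_ge0.
rewrite big_map.
apply: (@le_trans _ _ (\sum_(x <- s) (c0 * p.+1%:R) ^+ p * (alpha * opnorm (H (h x))))).
  apply: ler_sum => x _.
  (* A single term occupies one block, so [m = 1]. *)
  apply: le_trans (nest_local p (supported_term (g := h x) _) (_ : _ <= 1 * k)%N) _.
    by rewrite size_tuple mul1n.
  rewrite add1n ler_wpM2l//; apply: le_trans (opnormZ _ _) _.
  by rewrite ler_wpM2r ?opnorm_ge0.
by rewrite -mulr_sumr -mulr_sumr (s_sum (fun g => opnorm (H g))) !mulrA.
Qed.

End Locality.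

(** * Algebra and trace orthogonality of Pauli strings *)

Section Pauli.
Local Open Scope complex_scope.
Set Implicit Arguments.
Unset Strict Implicit.
Variables (R : realType) (NL nq : nat).
Local Notation M := 'M[R[i]]_(Defs.dim NL nq).
Local Notation pauli1 := (@Defs.pauli1 R).
Local Notation pauli_mx := (@Defs.pauli_mx R NL nq).
Implicit Types (P Q : pstring NL nq).

Lemma sum_bstate (F : Defs.basis NL nq -> R[i]) :
  \sum_(i < Defs.dim NL nq) F (bstate i) = \sum_f F f.
Proof.
rewrite [RHS](reindex (@bstate NL nq)) //; apply: onW_bij.
exact: enum_val_bij.
Qed.

(** A sum over all bit strings of a product over qubits is the product of the one-bit sums; products
    of strings are thereby reduced to 2 by 2 matrices. *)
Lemma pauli_mxM P Q i j : (pauli_mx P * pauli_mx Q) i j =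
  \prod_(q : qubit NL nq) \sum_b pauli1 (P q) (bstate i q) b * pauli1 (Q q) b (bstate j q).
Proof.
rewrite bigA_distr_bigA/= -sum_bstate -mulmxE mxE; apply: eq_bigr => k _.
by rewrite !mxE -big_split.
Qed.

Lemma bstate_inj : injective (@bstate NL nq).
Proof. exact: enum_val_inj. Qed.

Lemma prod_delta (x y : Defs.basis NL nq) :
  \prod_(q : qubit NL nq) ((x q == y q)%:R : R[i]) = (x == y)%:R.
Proof.
have [->|xy] := eqVneq x y; first by rewrite big1// => q _; rewrite eqxx.
have [q qxy] : exists q, x q != y q.
  apply/existsP; apply: contraR xy; rewrite negb_exists => /forallP e.
  by apply/eqP/ffunP => q; apply/eqP; have := e q; rewrite negbK.
by rewrite (bigD1 q)//= (negPf qxy) mul0r.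
Qed.

Lemma pauli_mx_sqr P : pauli_mx P * pauli_mx P = 1.
Proof.
apply/matrixP => i j; rewrite pauli_mxM mxE -(inj_eq bstate_inj) -prod_delta.
apply: eq_bigr => q _; rewrite big_bool/=.
by case: (P q) (bstate i q) (bstate j q) => -[] [] /=; apply/eqP;
  rewrite eq_complex/=; apply/andP; split; apply/eqP; ring.
Qed.

Lemma pauli_mx_adj P : adjmx (pauli_mx P) = pauli_mx P.
Proof.
apply/matrixP => i j; rewrite !mxE rmorph_prod; apply: eq_bigr => q _.
by case: (P q) (bstate i q) (bstate j q) => -[] [] /=; apply/eqP;
  rewrite eq_complex/=; apply/andP; split; apply/eqP; ring.
Qed.

Lemma pauli_mx_opnorm P : opnorm (pauli_mx P) <= 1.
Proof. by apply: unitary_opnorm; rewrite /unitary pauli_mx_adj pauli_mx_sqr. Qed.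

Lemma pauli_mx_comm P Q : (forall q, P q = PI \/ Q q = PI) ->
  pauli_mx P * pauli_mx Q = pauli_mx Q * pauli_mx P.
Proof.
move=> PQ; apply/matrixP => i j; rewrite !pauli_mxM; apply: eq_bigr => q _.
rewrite !big_bool/=; case: (PQ q) => ->.
  by case: (Q q) (bstate i q) (bstate j q) => -[] [] /=; ring.
by case: (P q) (bstate i q) (bstate j q) => -[] [] /=; ring.
Qed.

(** The trace factors over the qubits, and at [q] the product of two different Pauli matrices is
    traceless. *)
Lemma pauli_mx_trace0 P Q q : P q <> Q q -> \tr (pauli_mx P * pauli_mx Q) = 0.
Proof.
move=> PQ; rewrite /mxtrace.
under eq_bigr do rewrite pauli_mxM.
rewrite (sum_bstate (fun f => \prod_(q : qubit NL nq)
  \sum_b pauli1 (P q) (f q) b * pauli1 (Q q) b (f q))).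
rewrite -(bigA_distr_bigA (fun (q : qubit NL nq) x =>
  \sum_b pauli1 (P q) x b * pauli1 (Q q) b x))/=.
rewrite (bigD1 q)//= !big_bool/=.
suff -> : pauli1 (P q) true true * pauli1 (Q q) true true +
  pauli1 (P q) true false * pauli1 (Q q) false true +
  (pauli1 (P q) false true * pauli1 (Q q) true false +
  pauli1 (P q) false false * pauli1 (Q q) false false) = 0 by rewrite mul0r.
case: (P q) (Q q) PQ => -[] // _ /=; apply/eqP;
  rewrite eq_complex/=; apply/andP; split; apply/eqP; ring.
Qed.

Lemma dim_gt0 : (0 < Defs.dim NL nq)%N.
Proof. by rewrite /Defs.dim card_ffun card_bool expn_gt0. Qed.

(* Distinct Pauli strings are orthogonal for the trace form, so pairing with
   [s i] isolates the coefficient [c i]. *)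
Lemma hermitian_pauli_coef_real n (c : 'I_n -> R[i]) (s : 'I_n -> pstring NL nq) :
  (forall i j, (forall q, s i q = s j q) -> i = j) ->
  Defs.hermitian (\sum_(i < n) c i *: pauli_mx (s i)) ->
  forall i, conjc (c i) = c i.
Proof.
move=> sI; rewrite /Defs.hermitian raddf_sum/= => herm i.
have tr (e : 'I_n -> R[i]) :
    \tr ((\sum_(j < n) e j *: pauli_mx (s j)) *m pauli_mx (s i)) = e i * (Defs.dim NL nq)%:R.
  rewrite mulmx_suml raddf_sum/= (bigD1 i)//= big1 => [|j ji].
    by rewrite addr0 -scalemxAl mxtraceZ mulmxE pauli_mx_sqr mxtrace1.
  rewrite -scalemxAl mxtraceZ mulmxE.
  have [q qP] : exists q, s j q <> s i q.
    apply/not_existsP => e'; move/eqP: ji; apply; apply: sI => q.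
    by apply: contrapT; exact: e'.
  by rewrite (pauli_mx_trace0 qP) mulr0.
have := tr (fun i => conjc (c i)).
under eq_bigr do rewrite -[pauli_mx _]pauli_mx_adj -adjmxZ.
rewrite herm tr => E; apply: (mulIf _ (esym E)).
by rewrite pnatr_eq0 -lt0n dim_gt0.
Qed.

End Pauli.

(** * Product formulas as flattened lists of exponentials *)

Section ProductFormula.
Local Open Scope complex_scope.
Set Implicit Arguments.
Unset Strict Implicit.
Variables (R : realType) (d : nat).
Local Notation M := 'M[R[i]]_d.

Lemma expiHE (t : R) (A : M) : expiH t A = mexp (- 'i *: A) t.
Proof. by rewrite /expiH /mexp scalerA [- 'i * _]mulrC. Qed.

Lemma hermitian_skew (A : M) : Defs.hermitian A -> skew (- 'i *: A).
Proof.
rewrite /Defs.hermitian /skew adjmxZ => ->; rewrite -scaleNr; congr (_ *: _).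
by apply/eqP; rewrite eq_complex/= !oppr0 !opprK !eqxx.
Qed.

Lemma hermitian_sum n (Hg : 'I_n -> M) : (forall g, Defs.hermitian (Hg g)) ->
  Defs.hermitian (\sum_g Hg g).
Proof.
by move=> Hh; rewrite /Defs.hermitian raddf_sum; apply: eq_bigr => g _; exact: Hh.
Qed.

Variables (n Ups : nat) (Hg : 'I_n -> M) (a : 'I_Ups -> 'I_n -> R).
Variable sigma : 'I_Ups -> 'S_n.
Hypothesis Hg_herm : forall g, Defs.hermitian (Hg g).

Definition pf_idx : seq ('I_Ups * 'I_n) :=
  [seq (u, i) | u <- index_enum 'I_Ups, i <- index_enum 'I_n].
Definition pf_term (x : 'I_Ups * 'I_n) := sigma x.1 x.2.
Definition pf_coef (theta : R) (x : 'I_Ups * 'I_n) : R[i] :=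
  (theta * a x.1 (pf_term x))%:C * - 'i.
(** With [theta] absorbed into the matrices, [trotter_error], stated for non-negative times, covers
    [theta] of either sign at time 1. *)
Definition pf_list theta := [seq pf_coef theta x *: Hg (pf_term x) | x <- pf_idx].

(** Each of the [Ups] stages runs through all terms in permuted order; this supplies [s_sum] with
    [N = Ups]. *)
Lemma pf_idx_sum (w : 'I_n -> R) :
  \sum_(x <- pf_idx) w (pf_term x) = Ups%:R * \sum_g w g.
Proof.
rewrite big_allpairs_dep /pf_term/=.
have E u : \sum_i w (sigma u i) = \sum_g w g.
  by rewrite [RHS](reindex_inj (@perm_inj _ (sigma u))).
under eq_bigr do rewrite E.
by rewrite sumr_const card_ord mulr_natl.
Qed.

Lemma skews_pf_list theta : skews (pf_list theta).
Proof.
move=> _ /mapP[x _ ->]; rewrite /pf_coef -scalerA.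
exact/skewZ/hermitian_skew.
Qed.

Lemma prodformulaE theta s :
  prodformula Hg a sigma (s * theta) = trot (pf_list theta) s.
Proof.
rewrite /trot big_map big_allpairs_dep/=.
apply: eq_bigr => u _; apply: eq_bigr => i _.
by rewrite expiHE /pf_coef -scalerA mexpZ mulrA.
Qed.

Lemma prodformula_unitary theta : unitary (prodformula Hg a sigma theta).
Proof.
by rewrite -[theta]mul1r prodformulaE; exact/trot_unitary/skews_pf_list.
Qed.

Lemma prodformula_error p theta : (0 < p)%N ->
  has_order p (prodformula Hg a sigma) (\sum_g Hg g) ->
  opnorm (prodformula Hg a sigma theta - expiH theta (\sum_g Hg g))
    <= \sum_(Y <- pf_list theta) nest p (pf_list theta) Y.
Proof.
move=> p0 [C [delta [delta0 ord]]].
set X : M := theta%:C *: (- 'i *: \sum_g Hg g).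
have sL : skews (pf_list theta) by exact: skews_pf_list.
have sX : skew X by exact/skewZ/hermitian_skew/hermitian_sum.
have E s : prodformula Hg a sigma (s * theta) - expiH (s * theta) (\sum_g Hg g) =
    trot (pf_list theta) s - mexp X s.
  by rewrite prodformulaE expiHE mexpZ.
have th0 : 0 < `|theta| + 1 by rewrite ltr_wpDl.
have E1 := E 1; rewrite mul1r in E1; rewrite E1.
rewrite -[leRHS]mulr1 -[X in _ <= _ * X](expr1n R p.+1).
(* The added 1 avoids a division by 0 and keeps s |theta| below [delta]. *)
have e0 : 0 < delta / (`|theta| + 1) by rewrite divr_gt0.
apply: (trotter_error (C := C * `|theta| ^+ p.+1) p0 sL sX e0 _ ler01) => s s0 sd.
have nE : `|s * theta| = s * `|theta| by rewrite normrM (ger0_norm s0).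
have sdelta : `|s * theta| < delta.
  rewrite nE; apply: (@le_lt_trans _ _ (s * (`|theta| + 1))).
    by apply: (ler_wpM2l s0); rewrite lerDl; exact: ler01.
  by move: sd; rewrite (ltr_pdivlMr _ _ th0).
rewrite -E; apply: le_trans (ord _ sdelta) _.
by rewrite nE exprMn -mulrA [_ ^+ _ * s ^+ _]mulrC.
Qed.

End ProductFormula.

(** * Accumulation of errors in products of unitaries *)

Section UnitaryProducts.
Local Open Scope complex_scope.
Set Implicit Arguments.
Unset Strict Implicit.
Variables (R : realType) (d : nat).
Local Notation M := 'M[R[i]]_d.

Lemma prod_unitary (I : Type) (r : seq I) (A : I -> M) :
  (forall i, unitary (A i)) -> unitary (\prod_(i <- r) A i).
Proof.
by move=> AU; elim/big_rec: _ => [|i x _]; [exact: unitary1|exact/unitaryM/AU].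
Qed.

(** Telescoping: factors are exchanged one at a time, and the unitaries around the difference have
    norm at most 1. *)
Lemma opnorm_prod_sub (I : Type) (r : seq I) (A B : I -> M) :
  (forall i, unitary (A i)) -> (forall i, unitary (B i)) ->
  opnorm (\prod_(i <- r) A i - \prod_(i <- r) B i)
    <= \sum_(i <- r) opnorm (A i - B i).
Proof.
move=> AU BU; elim: r => [|i r IH].
  by rewrite !big_nil subrr opnorm0.
rewrite !big_cons; set x := \prod_(j <- r) A j; set y := \prod_(j <- r) B j.
have -> : A i * x - B i * y = (A i - B i) * x + B i * (x - y).
  by rewrite mulrBl mulrBr addrA subrK.
apply: le_trans (opnormD _ _) _; apply: lerD.
  apply: le_trans (opnormM _ _) (ler_piMr (opnorm_ge0 _) _).
  exact/unitary_opnorm/prod_unitary.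
apply: le_trans (opnormM _ _) _; apply: le_trans IH.
exact/(ler_piMl (opnorm_ge0 _))/unitary_opnorm.
Qed.

Lemma opnormX_sub (A B : M) r : unitary A -> unitary B ->
  opnorm (A ^+ r - B ^+ r) <= r%:R * opnorm (A - B).
Proof.
move=> AU BU; have := opnorm_prod_sub (index_enum 'I_r) (fun=> AU) (fun=> BU).
by rewrite !prodr_const sumr_const card_ord mulr_natl.
Qed.

End UnitaryProducts.

(** * Errors of a single step, outer and inner *)

Section LocalPauliHamiltonian.
Local Open Scope complex_scope.
Set Implicit Arguments.
Unset Strict Implicit.
Variables (R : realType) (k NL nq NH : nat) (J : 'I_NH -> k.-tuple 'I_NL).
Variables (NPg : 'I_NH -> nat) (c : forall g, 'I_(NPg g) -> R[i]).
Variable s : forall g, 'I_(NPg g) -> pstring NL nq.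
Hypothesis data : local_pauli_data J c s.

Local Notation H := (Hterm c s).
Let Lam : R := (NP_of NPg)%:R * cP_of c.

Lemma cP_ge0 : 0 <= cP_of c.
Proof. exact: bigmax_ge_id. Qed.

Lemma cabs_le_cP g i : cabs (c (g := g) i) <= cP_of c.
Proof.
apply: le_trans (le_bigmax _ _ g).
exact: (le_bigmax _ (fun i => cabs (c i)) i).
Qed.

Lemma Lam_ge0 : 0 <= Lam.
Proof. by rewrite mulr_ge0// cP_ge0. Qed.

Lemma sum_pauli_opnorm_le g :
  \sum_(i < NPg g) opnorm (c i *: @pauli_mx R _ _ (s i)) <= Lam.
Proof.
apply: (@le_trans _ _ (\sum_(i < NPg g) cP_of c)).
  apply: ler_sum => i _; apply: le_trans (opnormZ _ _) _.
  apply: le_trans (cabs_le_cP i).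
  exact: (ler_piMr (cabs_ge0 _) (pauli_mx_opnorm _ _)).
rewrite sumr_const card_ord -mulr_natl ler_wpM2r ?cP_ge0// ler_nat.
exact: leq_bigmax.
Qed.

Lemma Hterm_opnorm g : opnorm (H g) <= Lam.
Proof. exact: le_trans (opnorm_sum _ _ _) (sum_pauli_opnorm_le g). Qed.

Lemma Hterm_hermitian g : Defs.hermitian (H g).
Proof. by case: data. Qed.

(** The Pauli coefficients of a Hermitian term are real; this is what makes the inner exponentials
    unitary. *)
Lemma pauli_term_hermitian g i : Defs.hermitian (c i *: @pauli_mx R _ _ (s (g := g) i)).
Proof.
case: data => _ _ sI _ herm.
rewrite /Defs.hermitian adjmxZ pauli_mx_adj.
by rewrite (hermitian_pauli_coef_real (sI g) (herm g)).
Qed.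

Lemma Hterm_comm g g' : ~~ has (mem (J g')) (J g) -> H g * H g' = H g' * H g.
Proof.
case: data => _ _ _ loc _ gg'.
apply: commr_sum => i _; apply: commr_sym; apply: commr_sum => j _.
rewrite /GRing.comm -!mulmxE -!scalemxAr -!scalemxAl !scalerA mulrC.
congr (_ *: _); rewrite !mulmxE; apply: pauli_mx_comm => q.
have [qJ|qJ] := boolP (q.1 \in J g); last by right; exact: loc.
left; apply: loc; apply: contra gg' => qJ'.
by apply/hasP; exists q.1.
Qed.

(** [Nind] counts the terms of a maximising pair, so the sum for another pair is compared first with
    the maximum and then with that count. *)
Lemma overlap_sum_le Nind l j : is_Nind J H Nind ->
  \sum_(g < NH | tnth (J g) l == j) opnorm (H g) <= Nind%:R * Lam.
Proof.
move=> [l0 [j0 [E <-]]].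
apply: (@le_trans _ _ (ind1norm J H)).
  apply: le_trans (le_bigmax _ _ l).
  exact: (le_bigmax _ (fun j => \sum_(g < NH | tnth (J g) l == j) opnorm (H g)) j).
rewrite -E mulr_natl -sumr_const.
rewrite [leRHS](eq_bigl (fun g => tnth (J g) l0 == j0)); last first.
  by move=> g; rewrite inE.
by apply: ler_sum => g _; exact: Hterm_opnorm.
Qed.

(* The constants come from [sum_nest_local] and [nest_le_norm] with
   [|||H|||_1 <= Nind * Lam] and [\sum_g ||H g|| <= NH * Lam]. *)
Definition outer_const p Ups (A : R) : R :=
  (2 * `|A| * Ups%:R * k%:R ^+ 2 * p.+1%:R) ^+ p * (`|A| * Ups%:R).

Lemma outer_step p Ups (A : R) Nind (a : 'I_Ups -> 'I_NH -> R) sigma theta :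
  (0 < p)%N -> is_Nind J H Nind -> valid_formula a A ->
  has_order p (prodformula H a sigma) (Hsum H) -> 0 <= theta ->
  opnorm (prodformula H a sigma theta - expiH theta (Hsum H))
    <= outer_const p Ups A * (Nind%:R ^+ p * NH%:R * (Lam * theta) ^+ p.+1).
Proof.
rewrite /Hsum => p0 HN [_ aA] ord th0.
apply: le_trans (prodformula_error Hterm_hermitian theta p0 ord) _.
have al0 : 0 <= theta * `|A| by rewrite mulr_ge0.
have mu0 : 0 <= Nind%:R * Lam by rewrite mulr_ge0// Lam_ge0.
have zle x : cabs (pf_coef a sigma theta x) <= theta * `|A|.
  rewrite /pf_coef cabsM cabs_real normrM (ger0_norm th0).
  have -> : cabs (- 'i : R[i]) = 1.
    by rewrite /cabs /csq/= oppr0 expr0n/= add0r sqrrN expr1n sqrtr1.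
  rewrite mulr1 ler_wpM2l//; apply: le_trans (aA _ _) (ler_norm _).
(* The locality bound is taken with alpha = theta |A|, [mu = Nind%:R * Lam] and [N = Ups]. *)
apply: le_trans (sum_nest_local al0 mu0 Hterm_comm
  (fun l j => overlap_sum_le l j HN) (pf_idx_sum sigma) zle p) _.
have SH : \sum_g opnorm (H g) <= NH%:R * Lam.
  apply: le_trans (ler_sum _ (fun g _ => Hterm_opnorm g)) _.
  by rewrite sumr_const card_ord mulr_natl.
apply: (@le_trans _ _ ((2 * (theta * `|A|) * Ups%:R * k%:R ^+ 2 * (Nind%:R * Lam)
    * p.+1%:R) ^+ p * (theta * `|A| * Ups%:R * (NH%:R * Lam)))).
  apply: ler_wpM2l; first by rewrite exprn_ge0// mulr_ge0// (mulr_ge0 _ mu0)// !mulr_ge0.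
  by apply: ler_wpM2l SH; rewrite mulr_ge0.
rewrite le_eqVlt; apply/orP; left; apply/eqP.
rewrite /outer_const [(Lam * theta) ^+ p.+1]exprS.
have -> : 2 * (theta * `|A|) * Ups%:R * k%:R ^+ 2 * (Nind%:R * Lam) * p.+1%:R =
  (2 * `|A| * Ups%:R * k%:R ^+ 2 * p.+1%:R) * (Nind%:R * (Lam * theta)) by ring.
rewrite [in LHS]exprMn [(Nind%:R * _) ^+ p]exprMn; ring.
Qed.

Definition inner_const p Ups (B : R) : R := 2 ^+ p * (`|B| * Ups%:R) ^+ p.+1.

Lemma inner_step p Ups (B : R) g (b : 'I_Ups -> 'I_(NPg g) -> R) sigma tau :
  (0 < p)%N -> valid_formula b B ->
  has_order p (prodformula (fun m => c m *: @pauli_mx R _ _ (s m)) b sigma) (H g) ->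
  opnorm (prodformula (fun m => c m *: @pauli_mx R _ _ (s m)) b sigma tau
     - expiH tau (H g)) <= inner_const p Ups B * (Lam * `|tau|) ^+ p.+1.
Proof.
move=> p0 [_ bB] ord.
apply: le_trans (prodformula_error (@pauli_term_hermitian g) tau p0 ord) _.
set L := pf_list _ _ _ _.
have SL : \sum_(Y <- L) opnorm Y <= `|B| * Ups%:R * (Lam * `|tau|).
  rewrite big_map.
  apply: (@le_trans _ _ (\sum_(x <- pf_idx (NPg g) Ups)
      `|tau| * `|B| * opnorm (c (pf_term sigma x) *: @pauli_mx R _ _ (s (pf_term sigma x))))).
    apply: ler_sum => x _; apply: le_trans (opnormZ _ _) _.
    apply: (ler_wpM2r (opnorm_ge0 _)).
    rewrite /pf_coef cabsM cabs_real normrM.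
    have -> : cabs (- 'i : R[i]) = 1.
      by rewrite /cabs /csq/= oppr0 expr0n/= add0r sqrrN expr1n sqrtr1.
    rewrite mulr1 ler_wpM2l//; apply: le_trans (bB _ _) (ler_norm _).
  rewrite -mulr_sumr (pf_idx_sum sigma (fun m => opnorm (c m *: @pauli_mx R _ _ (s m)))).
  have -> : `|B| * Ups%:R * (Lam * `|tau|) = `|tau| * `|B| * (Ups%:R * Lam) by ring.
  by do 2!rewrite ler_wpM2l ?mulr_ge0//; exact: sum_pauli_opnorm_le.
have S0 : 0 <= \sum_(Y <- L) opnorm Y by apply: sumr_ge0 => Y _; exact: opnorm_ge0.
apply: (@le_trans _ _ ((2 * \sum_(Y <- L) opnorm Y) ^+ p * \sum_(Y <- L) opnorm Y)).
  by rewrite mulr_sumr; apply: ler_sum => Y _; exact: nest_le_norm.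
rewrite exprMn -mulrA -exprSr /inner_const -mulrA -exprMn.
rewrite ler_wpM2l ?exprn_ge0// ler_pXn2r// ?nnegrE//.
exact: le_trans SL.
Qed.

End LocalPauliHamiltonian.

(** * Repetition of one step *)

Section Repetition.
Local Open Scope complex_scope.
Set Implicit Arguments.
Unset Strict Implicit.
Variables (R : realType) (d : nat).
Implicit Types S B : 'M[R[i]]_d.

Lemma expiH_unitary (t : R) B : Defs.hermitian B -> unitary (expiH t B).
Proof. by move=> hB; rewrite expiHE; exact/mexp_unitary/hermitian_skew. Qed.

Lemma expiH_expn (t : R) r B : Defs.hermitian B -> 0 <= t -> (0 < r)%N ->
  expiH t B = expiH (t / r%:R) B ^+ r.
Proof.
move=> hB t0 r0; rewrite !expiHE mexpX; first last.
- by rewrite divr_ge0.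
- exact: hermitian_skew.
by congr mexp; rewrite -[RHS]mulr_natr divfK// pnatr_eq0 -lt0n.
Qed.

Lemma mpow_sub_expiH (t : R) r S B : unitary S -> Defs.hermitian B -> 0 <= t ->
  (0 < r)%N -> opnorm (mpow S r - expiH t B)
    <= r%:R * opnorm (S - expiH (t / r%:R) B).
Proof.
move=> US hB t0 r0; rewrite mpowE (expiH_expn hB t0 r0).
exact: opnormX_sub US (expiH_unitary _ hB).
Qed.

End Repetition.

(** * Total errors of the outer and of the nested circuit *)

Section TotalErrors.
Local Open Scope complex_scope.
Set Implicit Arguments.
Unset Strict Implicit.
Variables (R : realType) (k NL nq NH : nat) (J : 'I_NH -> k.-tuple 'I_NL).
Variables (NPg : 'I_NH -> nat) (c : forall g, 'I_(NPg g) -> R[i]).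
Variable s : forall g, 'I_(NPg g) -> pstring NL nq.
Hypothesis data : local_pauli_data J c s.
Variables (p Ups Nind : nat) (A : R) (a : 'I_Ups -> 'I_NH -> R).
Variables (sigma : 'I_Ups -> 'S_NH) (t : R) (r : nat).
Hypothesis p0 : (0 < p)%N.
Hypothesis a_valid : valid_formula a A.
Hypothesis t0 : 0 < t.
Hypothesis r0 : (0 < r)%N.

Local Notation H := (Hterm c s).
Let Lam : R := (NP_of NPg)%:R * cP_of c.

Lemma step_ge0 : 0 <= t / r%:R.
Proof. by rewrite divr_ge0// ltW. Qed.

(** The origin of r^(-p): [r] steps, each with an error of order (t/r)^(p+1). *)
Lemma rescale_step (x : R) :
  r%:R * (x * (t / r%:R)) ^+ p.+1 = (x * t) ^+ p.+1 / r%:R ^+ p.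
Proof.
rewrite mulrA expr_div_n mulrC -mulrA; congr (_ * _).
by rewrite exprSr invfM -mulrA mulVf ?mulr1// pnatr_eq0 -lt0n.
Qed.

Lemma outer_error : is_Nind J H Nind ->
  has_order p (prodformula H a sigma) (Hsum H) ->
  opnorm (mpow (prodformula H a sigma (t / r%:R)) r - expiH t (Hsum H))
    <= outer_const k p Ups A * (Nind%:R ^+ p * NH%:R * (Lam * t) ^+ p.+1 / r%:R ^+ p).
Proof.
move=> HN ord.
have hH : Defs.hermitian (Hsum H) by apply: hermitian_sum => g; exact: (Hterm_hermitian data).
have US : unitary (prodformula H a sigma (t / r%:R)).
  by apply: prodformula_unitary => g; exact: (Hterm_hermitian data).
apply: le_trans (mpow_sub_expiH US hH (ltW t0) r0) _.
apply: le_trans (ler_wpM2l (ler0n _ _) (outer_step data p0 HN a_valid ord step_ge0)) _.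
rewrite le_eqVlt; apply/orP; left; apply/eqP.
by rewrite mulrCA [r%:R * _]mulrCA rescale_step !mulrA.
Qed.

Variables (Ups' : nat) (B : R).
Variable b : forall g, 'I_Ups' -> 'I_(NPg g) -> R.
Variable sigma' : forall g, 'I_Ups' -> 'S_(NPg g).
Hypothesis b_valid : forall g, valid_formula (@b g) B.
Hypothesis b_order : forall g, has_order p
  (prodformula (fun m : 'I_(NPg g) => c m *: @pauli_mx R _ _ (s m))
     (@b g) (@sigma' g)) (H g).

Definition nested_const : R := Ups%:R * inner_const p Ups' B * `|A| ^+ p.+1.

(** With one inner repetition everywhere, the circuits are compared factor by factor, at the price
    of [Ups * NH] inner errors in each of the [r] steps. *)
Lemma nested_error :
  opnorm (nested_circuit c s a sigma b sigma' t r (fun _ _ => 1%N)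
      - mpow (prodformula H a sigma (t / r%:R)) r)
    <= nested_const * (NH%:R * (Lam * t) ^+ p.+1 / r%:R ^+ p).
Proof.
pose S g tau := prodformula (fun m : 'I_(NPg g) => c m *: @pauli_mx R _ _ (s m))
     (@b g) (@sigma' g) tau.
have SU g tau : unitary (S g tau).
  by apply: prodformula_unitary => m; exact: (pauli_term_hermitian data).
have EU g tau : unitary (expiH tau (H g)).
  exact/expiH_unitary/(Hterm_hermitian data).
have -> : nested_circuit c s a sigma b sigma' t r (fun _ _ => 1%N) =
    (\prod_(u < Ups) \prod_(i < NH)
       S (sigma u i) (t / r%:R * a u (sigma u i))) ^+ r.
  rewrite /nested_circuit mpowE; congr (_ ^+ r).
  apply: eq_bigr => u _; apply: eq_bigr => i _.
  rewrite mpowE expr1 /S; congr prodformula.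
  by rewrite mulr1 mulrAC.
have -> : mpow (prodformula H a sigma (t / r%:R)) r =
    (\prod_(u < Ups) \prod_(i < NH)
       expiH (t / r%:R * a u (sigma u i)) (H (sigma u i))) ^+ r.
  by rewrite mpowE.
apply: le_trans (opnormX_sub _ _ _) _.
- by apply: prod_unitary => u; apply: prod_unitary.
- by apply: prod_unitary => u; apply: prod_unitary.
have stepE u g : opnorm (S g (t / r%:R * a u g) - expiH (t / r%:R * a u g) (H g))
    <= inner_const p Ups' B * `|A| ^+ p.+1 * (Lam * (t / r%:R)) ^+ p.+1.
  apply: le_trans (inner_step data _ p0 (b_valid g) (b_order g)) _.
  rewrite -[leRHS]mulrA; apply: ler_wpM2l.
    by rewrite /inner_const mulr_ge0 ?exprn_ge0// mulr_ge0.
  have L0 : 0 <= Lam by exact: Lam_ge0.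
  rewrite -[_ * cP_of c]/Lam -exprMn; apply: lerXn2r.
  - by rewrite nnegrE; apply: mulr_ge0 L0 _.
  - by rewrite nnegrE; apply: mulr_ge0 => //; exact: mulr_ge0 L0 step_ge0.
  rewrite [leRHS]mulrCA; apply: (ler_wpM2l L0).
  rewrite normrM (ger0_norm step_ge0) mulrC; apply: (ler_wpM2r step_ge0).
  by case: a_valid => _ aA; apply: le_trans (aA _ _) (ler_norm _).
have prodE : opnorm (\prod_(u < Ups) \prod_(i < NH) S (sigma u i) (t / r%:R * a u (sigma u i))
     - \prod_(u < Ups) \prod_(i < NH) expiH (t / r%:R * a u (sigma u i)) (H (sigma u i)))
   <= \sum_(u < Ups) \sum_(i < NH)
        inner_const p Ups' B * `|A| ^+ p.+1 * (Lam * (t / r%:R)) ^+ p.+1.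
  apply: le_trans (opnorm_prod_sub _ _ _) _.
  - by move=> u; apply: prod_unitary.
  - by move=> u; apply: prod_unitary.
  apply: ler_sum => u _; apply: le_trans (opnorm_prod_sub _ _ _) _ => //.
  by apply: ler_sum => i _; exact: stepE.
apply: le_trans (ler_wpM2l (ler0n _ _) prodE) _.
rewrite !sumr_const !card_ord -[_ *+ NH]mulr_natl -[_ *+ Ups]mulr_natl.
rewrite -[NH%:R * _ / _]mulrA -rescale_step /nested_const.
rewrite le_eqVlt; apply/orP; left; apply/eqP.
set X := (_ * (t / _)) ^+ _; clearbody X; ring.
Qed.

End TotalErrors.

(** * Arithmetic of the asymptotic scales *)

Section Scales.
Set Implicit Arguments.
Unset Strict Implicit.
Variable R : realType.

Lemma powR_invn_exprn (x : R) p : (0 < p)%N -> 0 <= x ->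
  (x `^ (p%:R)^-1) ^+ p = x.
Proof.
move=> p0 x0; rewrite -powR_mulrn ?powR_ge0// -powRrM mulVf ?powRr1//.
by rewrite pnatr_eq0 -lt0n.
Qed.

Lemma powR_1Dinvn_exprn (x : R) p : (0 < p)%N -> 0 <= x ->
  (x `^ (1 + (p%:R)^-1)) ^+ p = x ^+ p.+1.
Proof.
move=> p0 x0; rewrite -powR_mulrn ?powR_ge0// -powRrM mulrDl mul1r mulVf.
  by rewrite natr1 powR_mulrn.
by rewrite pnatr_eq0 -lt0n.
Qed.

(** The scale is the [r] at which the outer error, up to its constant, equals [eps]; the power [p]
    removes the roots. *)
Lemma trotter_scale_exprn Nind NH NP (cP t eps : R) p : (0 < p)%N ->
  0 <= cP -> 0 < t -> 0 < eps ->
  trotter_scale Nind NH NP cP t eps p ^+ p * eps =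
  Nind%:R ^+ p * NH%:R * (NP%:R * cP * t) ^+ p.+1.
Proof.
move=> p0 cP0 t0 eps0; rewrite /trotter_scale.
have x0 : 0 <= NP%:R * cP * t by rewrite !mulr_ge0// ltW.
rewrite expr_div_n (powR_invn_exprn p0 (ltW eps0)) divfK ?gt_eqF//.
rewrite [in LHS]exprMn [in LHS]exprMn -(powR_1Dinvn_exprn p0 x0).
by congr (_ * _ * _); exact: powR_invn_exprn.
Qed.

Lemma trotter_scale_ge0 Nind NH NP (cP t eps : R) p :
  0 <= trotter_scale Nind NH NP cP t eps p.
Proof. by rewrite /trotter_scale !mulr_ge0// ?invr_ge0 powR_ge0. Qed.

(** One factor [NH] splits off from its power 1 + 1/p: gates are Trotter steps times [NH * NP] Pauli
    exponentials, up to constants. *)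
Lemma gate_scaleE Nind NH NP (cP t eps : R) p : 0 <= cP -> 0 < t ->
  gate_scale Nind NH NP cP t eps p =
  trotter_scale Nind NH NP cP t eps p * NH%:R * NP%:R.
Proof.
move=> cP0 t0; rewrite /gate_scale /trotter_scale.
have -> : NH%:R * NP%:R * cP * t = NH%:R * (NP%:R * cP * t) by ring.
have p1 : 1 + (p%:R : R)^-1 != 0 by rewrite gt_eqF// ltr_pwDl// invr_ge0.
rewrite powRM ?mulr_ge0 ?(ltW t0)// powRD ?(negPf p1)// powRr1//.
ring.
Qed.

Lemma scale_bound Nind NH NP (cP t eps : R) p r (c : R) : (0 < p)%N -> (0 < r)%N ->
  0 <= cP -> 0 < t -> 0 < eps -> 0 < c ->
  c * trotter_scale Nind NH NP cP t eps p <= r%:R ->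
  Nind%:R ^+ p * NH%:R * (NP%:R * cP * t) ^+ p.+1 / r%:R ^+ p <= eps / c ^+ p.
Proof.
move=> p0 r0 cP0 t0 eps0 c0 le.
rewrite -(trotter_scale_exprn _ _ _ p0 cP0 t0 eps0) ler_pdivrMr ?exprn_gt0 ?ltr0n//.
rewrite mulrAC ler_pdivlMr ?exprn_gt0// mulrAC -exprMn mulrC.
apply: ler_wpM2l; first exact: ltW.
have s0 := trotter_scale_ge0 Nind NH NP cP t eps p.
by rewrite mulrC ler_pXn2r ?nnegrE// mulr_ge0// ltW.
Qed.

End Scales.

(** * Gate count, choice of constants and assembly *)

Lemma outer_const_ge0 (R : realType) (k p Ups : nat) (A : R) :
  0 <= outer_const k p Ups A.
Proof. by rewrite /outer_const mulr_ge0 ?exprn_ge0// !mulr_ge0// exprn_ge0. Qed.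

Lemma nested_const_ge0 (R : realType) (p Ups Ups' : nat) (A B : R) :
  0 <= nested_const p Ups A Ups' B.
Proof.
by rewrite /nested_const /inner_const !mulr_ge0 ?exprn_ge0// mulr_ge0.
Qed.

Lemma gate_count_ones_le (NH Ups Ups' : nat) (NPg : 'I_NH -> nat) (r : nat) :
  (gate_count Ups' NPg r (fun (_ : 'I_Ups) _ => 1) <=
    r * (Ups * (NH * (Ups' * NP_of NPg))))%N.
Proof.
rewrite /gate_count leq_mul2l; apply/orP; right.
apply: (@leq_trans (\sum_(u < Ups) \sum_(g < NH) Ups' * NP_of NPg)%N).
  apply: leq_sum => u _; apply: leq_sum => g _.
  by rewrite mul1n leq_mul2l; apply/orP; right; exact: leq_bigmax.
by rewrite !sum_nat_const !card_ord.
Qed.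

(** Each [C] is chosen before the lattice, the Hamiltonian, [t] and [eps], as the asymptotic
    notation demands; [c1] and [c2] are the two sides of the tight scaling of [r]. *)
Theorem theorem3p3 (R : realType) (k p Ups Ups' : nat) (A B c1 c2 : R) :
  (0 < p)%N -> 0 < c1 -> 0 < c2 ->
  (* Part 1: Trotter number sufficient for error eps *)
  (exists C : R,
    forall (NL nq NH : nat) (J : 'I_NH -> k.-tuple 'I_NL) (NPg : 'I_NH -> nat)
      (c : forall g, 'I_(NPg g) -> R[i]) (s : forall g, 'I_(NPg g) -> pstring NL nq)
      (Nind : nat) (a : 'I_Ups -> 'I_NH -> R) (sigma : 'I_Ups -> 'S_NH)
      (t eps : R) (r : nat),
    local_pauli_data J c s ->
    is_Nind J (Hterm c s) Nind ->
    valid_formula a A ->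
    has_order p (prodformula (Hterm c s) a sigma) (Hsum (Hterm c s)) ->
    0 < t -> 0 < eps -> (0 < r)%N ->
    C * trotter_scale Nind NH (NP_of NPg) (cP_of c) t eps p <= r%:R ->
    opnorm (mpow (prodformula (Hterm c s) a sigma (t / r%:R)) r
            - expiH t (Hsum (Hterm c s))) <= eps)
  /\
  (* Part 2: nested product formulas, tight Trotter number, gate count *)
  (exists C : R,
    forall (NL nq NH : nat) (J : 'I_NH -> k.-tuple 'I_NL) (NPg : 'I_NH -> nat)
      (c : forall g, 'I_(NPg g) -> R[i]) (s : forall g, 'I_(NPg g) -> pstring NL nq)
      (Nind : nat) (a : 'I_Ups -> 'I_NH -> R) (sigma : 'I_Ups -> 'S_NH)
      (b : forall g, 'I_Ups' -> 'I_(NPg g) -> R)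
      (sigma' : forall g, 'I_Ups' -> 'S_(NPg g))
      (t eps : R) (r : nat),
    local_pauli_data J c s ->
    is_Nind J (Hterm c s) Nind ->
    valid_formula a A ->
    has_order p (prodformula (Hterm c s) a sigma) (Hsum (Hterm c s)) ->
    (forall g, valid_formula (b g) B) ->
    (forall g, has_order p
        (prodformula (fun m : 'I_(NPg g) => c g m *: @pauli_mx R _ _ (s g m)) (b g) (sigma' g))
        (Hterm c s g)) ->
    0 < t -> 0 < eps -> (0 < r)%N ->
    c1 * trotter_scale Nind NH (NP_of NPg) (cP_of c) t eps p <= r%:R ->
    r%:R <= c2 * trotter_scale Nind NH (NP_of NPg) (cP_of c) t eps p ->
    exists r' : 'I_Ups -> 'I_NH -> nat,
      (forall u g, 0 < r' u g)%N /\
      opnorm (nested_circuit c s a sigma b sigma' t r r'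
              - expiH t (Hsum (Hterm c s))) <= C * eps /\
      (gate_count Ups' NPg r r')%:R
        <= C * gate_scale Nind NH (NP_of NPg) (cP_of c) t eps p).
Proof.
move=> p0 c10 c20.
set K1 := outer_const k p Ups A.
set K2 := nested_const p Ups A Ups' B.
have K10 : 0 <= K1 by exact: outer_const_ge0.
have K20 : 0 <= K2 by exact: nested_const_ge0.
split.
(* The added 1 makes the constant at least 1, so that [K1 <= (K1 + 1) ^+ p]. *)
- exists (K1 + 1) => NL nq NH J NPg c s Nind a sigma t eps r data HN av ord t0 eps0 r0 le.
  have C0 : 0 < K1 + 1 by rewrite ltr_wpDl.
  apply: le_trans (outer_error data p0 av t0 r0 HN ord) _.
  have X := scale_bound p0 r0 (cP_ge0 c) t0 eps0 C0 le.
  apply: le_trans (ler_wpM2l K10 X) _.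
  rewrite mulrA ler_pdivrMr ?exprn_gt0// mulrC; apply: (ler_wpM2l (ltW eps0)).
  apply: (@le_trans _ _ (K1 + 1)); first by rewrite lerDl.
  by rewrite -[leLHS]expr1; apply: ler_weXn2l => //; rewrite lerDr.
(* The first summand serves the error, the second the gate count. *)
exists ((K1 + K2) / c1 ^+ p + c2 * Ups%:R * Ups'%:R).
move=> NL nq NH J NPg c s Nind a sigma b sigma' t eps r data HN av ord bv bord t0 eps0 r0 le1 le2.
have cp0 : 0 < c1 ^+ p by rewrite exprn_gt0.
have C10 : 0 <= (K1 + K2) / c1 ^+ p by rewrite divr_ge0 ?addr_ge0// ltW.
have C20 : 0 <= c2 * Ups%:R * Ups'%:R by rewrite !mulr_ge0// ltW.
(* [Nind = 0] would make the upper bound on [r] zero, against [0 < r]. *)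
have Nind0 : (0 < Nind)%N.
  rewrite lt0n; apply/negP => /eqP N0; move: le2.
  by rewrite N0 /trotter_scale !mul0r mulr0 lern0 -leqn0 leqNgt r0.
(* With the tight [r], a single inner repetition is accurate enough. *)
exists (fun _ _ => 1%N); split=> //; split.
- set X := Nind%:R ^+ p * NH%:R * ((NP_of NPg)%:R * cP_of c * t) ^+ p.+1 / r%:R ^+ p.
  have XE : X <= eps / c1 ^+ p := scale_bound p0 r0 (cP_ge0 c) t0 eps0 c10 le1.
  have e1 := outer_error data p0 av t0 r0 HN ord.
  have e2 := nested_error data sigma p0 av t0 r0 bv bord.
  (* The nested error lacks the factor Nind^p, which is at least 1, so [X] dominates it as well. *)
  have X2 : NH%:R * ((NP_of NPg)%:R * cP_of c * t) ^+ p.+1 / r%:R ^+ p <= X.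
    rewrite /X -!mulrA ler_peMl//; last by rewrite exprn_ege1// ler1n.
    rewrite mulr_ge0// mulr_ge0 ?invr_ge0 ?exprn_ge0// mulr_ge0// mulr_ge0 ?(ltW t0)//.
    exact: cP_ge0.
  have e : opnorm (nested_circuit c s a sigma b sigma' t r (fun _ _ => 1%N)
      - expiH t (Hsum (Hterm c s))) <= (K1 + K2) * X.
    (* Triangle inequality through the outer circuit with exact exponentials. *)
    rewrite -[X in opnorm X](subrKA (mpow (prodformula (Hterm c s) a sigma (t / r%:R)) r)).
    apply: le_trans (opnormD _ _) _; rewrite [leRHS]mulrDl addrC; apply: lerD e1 _.
    exact: le_trans e2 (ler_wpM2l K20 X2).
  apply: le_trans e _; apply: le_trans (ler_wpM2l (addr_ge0 K10 K20) XE) _.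
  rewrite mulrCA mulrC; apply: (ler_wpM2r (ltW eps0)).
  by rewrite lerDl.
rewrite (gate_scaleE _ _ _ _ _ (cP_ge0 c) t0).
set T := trotter_scale _ _ _ _ _ _ _ in le2 *.
have T0 : 0 <= T by exact: trotter_scale_ge0.
apply: (@le_trans _ _ (c2 * Ups%:R * Ups'%:R * (T * NH%:R * (NP_of NPg)%:R))); last first.
  apply: ler_wpM2r; last by rewrite lerDr.
  by apply: mulr_ge0 => //; exact: mulr_ge0.
apply: (@le_trans _ _ (r * (Ups * (NH * (Ups' * NP_of NPg))))%:R).
  by rewrite ler_nat gate_count_ones_le.
rewrite !natrM.
have -> : c2 * Ups%:R * Ups'%:R * (T * NH%:R * (NP_of NPg)%:R) =
  c2 * T * (Ups%:R * (NH%:R * (Ups'%:R * (NP_of NPg)%:R))) by ring.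
by apply: ler_wpM2r le2; rewrite !mulr_ge0.
Qed.
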